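(* Let $d\ge 2$, let $S$ be a finite set, and let $Q$ be the transition matrix of a reversible Markov chain on $S$. Let $D$ be the Dobrushin coefficient of the chain (for degree $d$). If $D<1/d$, then the branching Markov process $\nu_Q$ corresponding to $Q$ on the $d$-regular tree $T_d$ is a factor of i.i.d. process, i.e. $\nu_Q\in F_d(S)$.
   Context: $T_d$ is the infinite $d$-regular tree with vertex set $V(T_d)$; $T_d^*$ is $T_d$ with a distinguished root $o$; $\mathrm{Aut}(T_d^* )$ is the group of root-preserving automorphisms. $I_d(M)$ is the set of $\mathrm{Aut}(T_d)$-invariant Borel probability measures on $M^{V(T_d)}$. Factor of i.i.d.: let $f:[0,1]^{V(T_d^* )}\to S$ be Borel measurable and invariant under $\mathrm{Aut}(T_d^* )$. Take i.i.d. uniform $[0,1]$ labels on $V(T_d)$ and give each vertex $v$ the value of $f$ evaluated on the labelling with the root placed at $v$. The law of the resulting random element of $S^{V(T_d)}$ is a factor of i.i.d. process; $F_d(S)$ is the set of all such laws. Branching Markov process $\nu_Q$: let $\pi$ be the reversible stationary distribution of $Q$. Choose the state of the root from $\pi$; then, going outward, given the state $s$ of a vertex, choose the states of its children (neighbors one step farther from the root) conditionally independently from $Q(s,\cdot)$. By reversibility the law $\nu_Q$ of the resulting random element of $S^{V(T_d)}$ is in $I_d(S)$. Dobrushin coefficient: for a vertex $v$ with neighbor set $N(v)$, $|N(v)|=d$, and $\omega\in S^{N(v)}$, let $B_{v,\omega}$ be the conditional distribution, under $\nu_Q$, of the state of $v$ given that the states on $N(v)$ are $\omega$; explicitly $B_{v,\omega}(s)\propto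 \pi(s)\prod_{u\in N(v)}Q(s,\omega(u))$. It is assumed that $B_{v,\omega}$ is well defined for all $\omega\in S^{N(v)}$, i.e. every $\omega\in S^{N(v)}$ has positive probability under $\nu_Q$. Then $$D=\sup\{d_{TV}(B_{v,\omega},B_{v,\omega'}):\ \omega,\omega'\in S^{N(v)},\ |\{u\in N(v):\omega(u)\ne\omega'(u)\}|=1\},$$ where $d_{TV}(P_1,P_2)=\frac12\sum_{s\in S}|P_1(s)-P_2(s)|$. *)

(* Defs.v *)
From HB Require Import structures.
From mathcomp Require Import all_boot all_order all_algebra finmap.
From mathcomp Require Import all_classical all_reals all_analysis.

Set Implicit Arguments.
Unset Strict Implicit.
Unset Printing Implicit Defensive.

Import Order.TTheory GRing.Theory Num.Theory.

Local Open Scope classical_set_scope.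
Local Open Scope ring_scope.

(* A vertex of T_d is a word in the letters 0, ..., d-1 without two equal
   consecutive letters, and its neighbours are obtained by prepending a letter
   or deleting the first one; equivalently, T_d is the Cayley graph of the free
   product of d copies of Z/2. *)

Definition reduced d (w : seq 'I_d) : bool := sorted (fun i j => i != j) w.

Record vertex (d : nat) := Vertex { word :> seq 'I_d; wordP : reduced word }.

HB.instance Definition _ d := [isSub for @word d].
HB.instance Definition _ d := [Countable of vertex d by <:].

Definition root d : vertex d := @Vertex d [::] isT.

Lemma reduced_behead d (w : seq 'I_d) : reduced w -> reduced (behead w).
Proof. by case: w => // i w /path_sorted. Qed.

(* The neighbour of v one step closer to the root (the root if v is the root) *)
Definition parent d (v : vertex d) : vertex d :=
  Vertex (reduced_behead (wordP v)).

Definition step_word d (i : 'I_d) (w : seq 'I_d) : seq 'I_d :=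
  if ohead w == Some i then behead w else i :: w.

Lemma reduced_step d (i : 'I_d) (w : seq 'I_d) :
  reduced w -> reduced (step_word i w).
Proof.
case: w => [|j w] //= rw; rewrite /step_word /=.
case: eqP => [_|ne]; first exact: path_sorted rw.
by rewrite /reduced /= rw andbT; apply/eqP => ij; apply: ne; rewrite ij.
Qed.

(* The map i |-> step i v is a bijection from 'I_d onto the neighbour set
   of v; when v is not the root, one of the values is parent v. *)
Definition step d (i : 'I_d) (v : vertex d) : vertex d :=
  Vertex (reduced_step i (wordP v)).

Definition adj d (u v : vertex d) : bool := [exists i, v == step i u].

Definition automorphism d (g : vertex d -> vertex d) : Prop :=
  bijective g /\ forall u v, adj (g u) (g v) = adj u v.

(* Right multiplication by v in the free product: the automorphism used to
   place the root at v *)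
Definition shift d (v w : vertex d) : vertex d :=
  foldr (@step d) v (word w).

Lemma step_inj d (v : vertex d) : injective (fun i => step i v).
Proof.
move=> i j /(congr1 (@word d)) /=; rewrite /step_word.
case: v => -[|k w] _ /=; first by case.
case: eqP => [[<-]|_]; case: eqP => [[ki]|_] //.
- by move/(congr1 size) => /=; elim: (size w) => // n IH [/IH].
- by move/(congr1 size) => /=; elim: (size w) => // n IH [/IH].
- by case.
Qed.

Lemma stepK d (i : 'I_d) : involutive (step i).
Proof.
move=> [w rw]; apply: val_inj; rewrite /= /step_word.
case: w rw => [|j w] rw /=; first by rewrite eqxx.
case: (Some j =P Some i) => [[ji]|_] /=; last by rewrite eqxx.
case: w rw => [|k w] /=; first by rewrite ji.
by rewrite /reduced /= ji => /andP[ik _]; case: eqP => // -[ki]; rewrite ki eqxx in ik.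
Qed.

Lemma shift_step d (v : vertex d) (i : 'I_d) (w : vertex d) :
  shift v (step i w) = step i (shift v w).
Proof.
case: w => -[|j w] rw //; rewrite /shift /= /step_word /=.
by case: eqP => [[->]|_] //=; rewrite stepK.
Qed.

Lemma shift_root d (v : vertex d) : shift v (root d) = v.
Proof. by []. Qed.

Lemma foldr_stepK d (s : seq 'I_d) :
  cancel (fun u : vertex d => foldr (@step d) u s)
         (fun u => foldr (@step d) u (rev s)).
Proof.
elim: s => [|i s IH] u //=.
by rewrite rev_cons -cats1 foldr_cat /= stepK IH.
Qed.

Lemma shift_word d (w : vertex d) : shift (root d) w = w.
Proof.
case: w => w; elim: w => [|i w IH] rw; first exact: val_inj.
have rw' := path_sorted rw.
have -> : Vertex rw = step i (Vertex rw').
  apply: val_inj; rewrite /= /step_word.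
  case: w rw {IH rw'} => //= j w; rewrite /reduced /= => /andP[ij _].
  by case: eqP => // -[ji]; rewrite ji eqxx in ij.
by rewrite shift_step IH.
Qed.

Lemma shift_foldr d (v u : vertex d) (s : seq 'I_d) :
  shift v (foldr (@step d) u s) = foldr (@step d) (shift v u) s.
Proof. by elim: s => //= i s IH; rewrite shift_step IH. Qed.

Lemma shift_automorphism d (v : vertex d) : automorphism (shift v).
Proof.
have [v' v'K Kv'] : exists2 v', shift v v' = root d & shift v' v = root d.
  have E : foldr (@step d) v (rev (word v)) = root d.
    by rewrite -{1}[v]shift_word; exact: foldr_stepK.
  pose v' := foldr (@step d) (root d) (rev (word v)).
  exists v'; first by rewrite shift_foldr shift_root.
  by have := foldr_stepK (rev (word v)) (root d); rewrite revK.
have sK a b w : shift a (shift b w) = shift (shift a b) w.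
  by rewrite {2}/shift shift_foldr.
have bij : bijective (shift v).
  by exists (shift v') => w; rewrite sK ?v'K ?Kv' shift_word.
split=> // a b; apply/existsP/existsP => -[i /eqP E]; exists i.
- by apply/eqP/(bij_inj bij); rewrite E shift_step.
- by rewrite E shift_step.
Qed.

(* M^V with the product sigma-algebra *)

Definition cylinders (V : Type) dM (M : measurableType dM) :
    set (set (V -> M)) :=
  [set A | exists v (B : set M), measurable B /\ A = [set x | B (x v)]].

Definition configuration (V : Type) dM (M : measurableType dM) : Type :=
  g_sigma_algebraType (@cylinders V dM M).

HB.instance Definition _ V dM (M : measurableType dM) :=
  Measurable.on (@configuration V dM M).

(* [0,1] with its Borel sigma-algebra, the trace of that of R *)

Definition unit_points (R : realType) : Type := {i01 R}.

HB.instance Definition _ (R : realType) := Choice.on (unit_points R).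
HB.instance Definition _ (R : realType) :=
  isPointed.Build (unit_points R) (0%:i01 : {i01 R}).

Definition unit_val (R : realType) (x : unit_points R) : R :=
  (x : {i01 R})%:num.

Definition unit_interval (R : realType) : Type :=
  g_sigma_algebra_preimageType (@unit_val R).

HB.instance Definition _ (R : realType) := Measurable.on (unit_interval R).

Definition uniform_law (R : realType) (B : set (unit_interval R)) : \bar R :=
  lebesgue_measure (@unit_val R @` B).

(* Measurable types are pointed in the library, so a finite state space comes
   with an arbitrary point, which is used nowhere else: this is a nonempty
   finite set. *)

#[short(type="pointedFinType")]
HB.structure Definition PointedFinite := {S of Finite S & Pointed S}.

Definition discrete (S : Type) : Type := S.

HB.instance Definition _ (S : pointedFinType) :=
  PointedFinite.on (discrete S).
HB.instance Definition _ (S : pointedFinType) :=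
  @isMeasurable.Build default_measure_display (discrete S)
    discrete_measurable discrete_measurable0
    discrete_measurableC discrete_measurableU.

Definition labelling (d : nat) (R : realType) :=
  configuration (vertex d) (unit_interval R).

Definition coloring (d : nat) (S : pointedFinType) :=
  configuration (vertex d) (discrete S).

(* mu is the product of the uniform laws on [0,1]. *)
Definition iid_uniform d (R : realType)
    (mu : probability (labelling d R) R) : Prop :=
  forall (F : {fset vertex d}) (B : vertex d -> set (unit_interval R)),
    (forall v, measurable (B v)) ->
    mu [set x | forall v, v \in F -> B v (x v)]
      = (\prod_(v <- F) uniform_law (B v))%E.

Definition root_invariant d (R : realType) (S : Type)
    (f : labelling d R -> S) : Prop :=
  forall g, automorphism g -> g (root d) = root d ->
  forall x : labelling d R, f (x \o g) = f x.

(* When f is root_invariant, any automorphism taking the root to v may be used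
   in place of shift v. *)
Definition factor_map d (R : realType) (S : pointedFinType)
    (f : labelling d R -> discrete S) (x : labelling d R) : coloring d S :=
  fun v => f (x \o shift v).

Definition factor_of_iid d (R : realType) (S : pointedFinType) :
    set (probability (coloring d S) R) :=
  [set nu | exists2 mu : probability (labelling d R) R, iid_uniform mu &
    exists f : labelling d R -> discrete S,
      [/\ measurable_fun setT f, root_invariant f &
          forall A, measurable A -> nu A = pushforward mu (factor_map f) A]].

Definition reversible_chain (R : realType) (S : finType)
    (pi : S -> R) (Q : S -> S -> R) : Prop :=
  [/\ (forall s, 0 <= pi s) /\ \sum_s pi s = 1,
      (forall s t, 0 <= Q s t) /\ (forall s, \sum_t Q s t = 1) &
      forall s t, pi s * Q s t = pi t * Q t s].

(* nu is the law of the branching Markov process nu_Q: sampling outward from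
   the root gives, on every finite subtree F containing the root, the
   probability pi(x_root) times the product of Q(x_(parent v), x_v) over the
   other vertices v of F. These cylinder probabilities determine nu. *)
Definition branching_markov d (R : realType) (S : pointedFinType)
    (pi : S -> R) (Q : S -> S -> R)
    (nu : probability (coloring d S) R) : Prop :=
  forall (F : {fset vertex d}) (x : vertex d -> S),
    root d \in F -> (forall v, v \in F -> parent v \in F) ->
    nu [set y | forall v, v \in F -> y v = x v]
      = (pi (x (root d))
         * \prod_(v <- F | v != root d) Q (x (parent v)) (x v))%:E.

(* A configuration on the neighbours of a vertex v is indexed by 'I_d through
   the bijection i |-> step i v; nbhd_weight pi Q w s is the nu_Q-probability
   that v has state s and N(v) has states w, and nbhd_prob pi Q w that of w. *)

Definition nbhd_weight d (R : realType) (S : finType)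
    (pi : S -> R) (Q : S -> S -> R) (w : {ffun 'I_d -> S}) (s : S) : R :=
  pi s * \prod_i Q s (w i).

Definition nbhd_prob d (R : realType) (S : finType)
    (pi : S -> R) (Q : S -> S -> R) (w : {ffun 'I_d -> S}) : R :=
  \sum_s nbhd_weight pi Q w s.

(* The conditional law B_{v,w} of the state of v given w on N(v) *)
Definition cond_law d (R : realType) (S : finType)
    (pi : S -> R) (Q : S -> S -> R) (w : {ffun 'I_d -> S}) (s : S) : R :=
  nbhd_weight pi Q w s / nbhd_prob pi Q w.

Definition dTV (R : realType) (S : finType) (P1 P2 : S -> R) : R :=
  2^-1 * \sum_s `|P1 s - P2 s|.

(* If #|S| = 1 the set is empty and the supremum is 0 by convention. *)
Definition dobrushin (d : nat) (R : realType) (S : finType)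
    (pi : S -> R) (Q : S -> S -> R) : R :=
  sup [set r | exists w w' : {ffun 'I_d -> S},
         #|[set i | w i != w' i]%SET| = 1%N /\
         r = dTV (cond_law pi Q w) (cond_law pi Q w')].

(* Main.v *)
(* Run parallel Glauber dynamics from the distant past. At each time a random
   set of pairwise non-adjacent vertices, chosen by fair bits, is resampled from
   the conditional law given the neighbours. Let W_k be the configuration at
   time 0 of the dynamics started at time -k from a constant configuration.
   Whenever a vertex is resampled, the trajectory of W_(k+1) is drawn from the
   maximal coupling given that of W_k, so that one time step multiplies the
   probability of disagreement at a vertex by at most 1 - p (1 - d D) < 1, where
   p is the probability that a given vertex is resampled. The W_k are functions
   of i.i.d. labels that commute with automorphisms, and by summability W_k(v)
   is almost surely eventually constant, so the limit is a factor of i.i.d.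
   Coupling the trajectory of W_k in the same way to a trajectory started from
   nu_Q, which the dynamics preserves by reversibility, shows that the limit has
   law nu_Q. *)

From HB Require Import structures.
Require Import Defs.
From mathcomp Require Import all_boot all_order all_algebra finmap.
From mathcomp Require Import all_classical all_reals all_analysis.
From mathcomp Require Import measurable_realfun ring lra.

Set Implicit Arguments.
Unset Strict Implicit.
Unset Printing Implicit Defensive.

Import Order.TTheory GRing.Theory Num.Theory.
Import numFieldNormedType.Exports.

Local Open Scope classical_set_scope.
Local Open Scope ring_scope.

Local Notation root := Defs.root.

(** * Finite product measures *)

Section IteratedSums.
Context (I : choiceType) (A : finType).
Implicit Types (c : I -> A) (s t : seq I) (i : I).

(** At a given vertex, [W_k] reads only finitely many noise coordinates. Every estimate on the
    dynamics is therefore a statement about finite weighted sums over a finite noise alphabet;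
    measure theory is confined to the passage from [0,1] labels to noise and to the final limit.

    Two obstacles shape the construction. All pairs of consecutive trajectories must be coupled on
    one probability space: each trajectory gets a layer of fresh noise, and an innovation is drawn
    at every vertex and time, resampled or not, given the innovation of the previous layer, so that
    its law given the past is exactly the conditional law. Moreover automorphisms permute neighbours
    arbitrarily, so the update rule may see the neighbours only through the conditional law, which
    is symmetric in them.

    The branching sample has a preferred root; it only starts a comparison trajectory and never
    enters the factor. Since adjacent vertices never move together, a parallel step amounts to
    successive single-site updates, each governed by detailed balance. *)

Definition upd c i a : I -> A := fun j => if j == i then a else c j.

Lemma upd_same c i a : upd c i a i = a.
Proof. by rewrite /upd eqxx. Qed.

Lemma upd_other c i a j : j != i -> upd c i a j = c j.
Proof. by rewrite /upd => /negbTE ->. Qed.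

Lemma upd_id c i : upd c i (c i) = c.
Proof. by apply/funext => j; rewrite /upd; case: eqP => // ->. Qed.

Lemma upd_upd c i a b : upd (upd c i a) i b = upd c i b.
Proof. by apply/funext => j; rewrite /upd; case: eqP. Qed.

Lemma updC c i j a b : i != j -> upd (upd c i a) j b = upd (upd c j b) i a.
Proof.
move=> ij; apply/funext => k; rewrite /upd.
by case: eqP => // ->; case: eqP => // ji; rewrite ji eqxx in ij.
Qed.

Definition depends T s (g : (I -> A) -> T) :=
  forall c c', {in s, c =1 c'} -> g c = g c'.

Definition ignores T s (g : (I -> A) -> T) :=
  forall c c', (forall i, i \notin s -> c i = c' i) -> g c = g c'.

Definition local T (g : (I -> A) -> T) := exists s, depends s g.

Lemma depends_sub T s t (g : (I -> A) -> T) :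
  {subset s <= t} -> depends s g -> depends t g.
Proof. by move=> st dg c c' cc'; apply: dg => i /st; exact: cc'. Qed.

Lemma ignores_sub T s t (g : (I -> A) -> T) :
  {subset t <= s} -> ignores s g -> ignores t g.
Proof.
move=> ts ig c c' cc'; apply: ig => i si; apply: cc'.
by apply: contra si; exact: ts.
Qed.

Lemma local_cst T (x : T) : local (fun _ => x).
Proof. by exists [::]. Qed.

Lemma local_coord i : local (fun c => c i).
Proof. by exists [:: i] => c c' -> //; rewrite inE. Qed.

Lemma local_comp T U (h : T -> U) g : local g -> local (fun c => h (g c)).
Proof. by move=> [s dg]; exists s => c c' /dg ->. Qed.

Lemma local_comp2 T1 T2 U (h : T1 -> T2 -> U) g1 g2 :
  local g1 -> local g2 -> local (fun c => h (g1 c) (g2 c)).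
Proof.
move=> [s1 d1] [s2 d2]; exists (s1 ++ s2) => c c' cc'.
by rewrite (d1 c c') ?(d2 c c')// => i si; apply: cc'; rewrite mem_cat si ?orbT.
Qed.

Lemma local_comp3 T1 T2 T3 U (h : T1 -> T2 -> T3 -> U) g1 g2 g3 :
  local g1 -> local g2 -> local g3 -> local (fun c => h (g1 c) (g2 c) (g3 c)).
Proof.
move=> l1 l2 l3.
by apply: (local_comp2 (fun f x => f x) (local_comp2 h l1 l2) l3).
Qed.

Lemma local_seq (J : eqType) T (r : seq J) (g : J -> (I -> A) -> T) :
  (forall j, local (g j)) ->
  exists s, forall c c', {in s, c =1 c'} -> {in r, forall j, g j c = g j c'}.
Proof.
move=> lg; elim: r => [|j r [s IH]]; first by exists [::].
have [t dj] := lg j; exists (t ++ s) => c c' cc' k; rewrite inE => /predU1P[->|kr].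
  by apply: dj => i it; apply: cc'; rewrite mem_cat it.
by apply: IH kr => i si; apply: cc'; rewrite mem_cat si orbT.
Qed.

Lemma local_seqP (J : eqType) T U (r : seq J) (g : J -> (I -> A) -> T)
    (h : (J -> T) -> U) :
  (forall j, local (g j)) ->
  (forall f f', {in r, f =1 f'} -> h f = h f') ->
  local (fun c => h (fun j => g j c)).
Proof.
move=> lg dh; have [s ds] := local_seq r lg.
by exists s => c c' /ds; exact: dh.
Qed.

Lemma local_fin (J : finType) T U (g : J -> (I -> A) -> T) (h : (J -> T) -> U) :
  (forall j, local (g j)) -> local (fun c => h (fun j => g j c)).
Proof.
move=> lg; apply: (local_seqP (r := enum J)) => // f f' ff'.
by congr h; apply/funext => j; apply: ff'; rewrite mem_enum.
Qed.

Context (R : realFieldType) (th : A -> R).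

Fixpoint isum s (g : (I -> A) -> R) c : R :=
  if s is i :: s' then \sum_a th a * isum s' g (upd c i a) else g c.

Lemma eq_isum s g h c :
  (forall c', (forall i, i \notin s -> c' i = c i) -> g c' = h c') ->
  isum s g c = isum s h c.
Proof.
elim: s c => [|i s IH] c gh /=; first exact: gh.
apply: eq_bigr => a _; congr (_ * _); apply: IH => c' cc'.
apply: gh => j; rewrite inE negb_or => /andP[ji js].
by rewrite cc'// upd_other.
Qed.

Lemma isumD s g h c :
  isum s (fun c => g c + h c) c = isum s g c + isum s h c.
Proof.
elim: s c => //= i s IH c.
by rewrite -big_split /=; apply: eq_bigr => a _; rewrite IH mulrDr.
Qed.

Lemma isumZ k s g c : ignores s k ->
  isum s (fun c => k c * g c) c = k c * isum s g c.
Proof.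
elim: s c => //= i s IH c ik; rewrite mulr_sumr; apply: eq_bigr => a _.
rewrite IH; last by apply: ignores_sub ik => j js; rewrite inE js orbT.
rewrite mulrCA; congr (_ * _); apply: ik => j.
by rewrite inE negb_or => /andP[ji _]; rewrite upd_other.
Qed.

Lemma isumZl (k : R) s g c : isum s (fun c => k * g c) c = k * isum s g c.
Proof. by apply: (@isumZ (fun _ => k)). Qed.

Lemma isum_cat s t g c : isum (s ++ t) g c = isum s (isum t g) c.
Proof.
by elim: s c => //= i s IH c; apply: eq_bigr => a _; rewrite IH.
Qed.

Lemma isum1C i s g c :
  isum [:: i] (isum s g) c = isum s (isum [:: i] g) c.
Proof.
elim: s c => //= j s IH c.
have [->{j}|ij] := eqVneq j i.
  by apply: eq_bigr => a _; rewrite -IH.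
under eq_bigr do rewrite mulr_sumr.
rewrite exchange_big /=; apply: eq_bigr => b _.
rewrite -IH /= mulr_sumr; apply: eq_bigr => a _.
by rewrite mulrCA updC // eq_sym.
Qed.

Lemma isumC s t g c : isum s (isum t g) c = isum t (isum s g) c.
Proof.
elim: s c => //= i s IH c.
under eq_bigr do rewrite IH.
exact: (isum1C i t (isum s g) c).
Qed.

Lemma depends_isum s t g : depends (s ++ t) g -> depends t (isum s g).
Proof.
elim: s t => //= i s IH t dg c c' cc'.
apply: eq_bigr => a _; congr (_ * _).
have d1 : depends (i :: t) (isum s g).
  by apply: IH; apply: depends_sub dg => j; rewrite !(inE, mem_cat) orbCA.
by apply: d1 => j; rewrite inE /upd; case: eqP => //= _ /cc'.
Qed.

Lemma depends_isumT s g c c' : depends s g -> isum s g c = isum s g c'.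
Proof.
move=> dg; have d : depends [::] (isum s g) by apply: depends_isum; rewrite cats0.
exact: d.
Qed.

Lemma local_isum s g : local g -> local (isum s g).
Proof.
move=> [t dg]; exists t; apply: depends_isum; apply: depends_sub dg => i it.
by rewrite mem_cat it orbT.
Qed.

Lemma isum_uniq_prod s (h : I -> A -> R) c : uniq s ->
  isum s (fun c => \prod_(i <- s) h i (c i)) c
  = \prod_(i <- s) \sum_a th a * h i a.
Proof.
elim: s c => [|i s IH] c /=; first by rewrite !big_nil.
move=> /andP[nis us]; rewrite big_cons mulr_suml; apply: eq_bigr => a _.
rewrite -mulrA; congr (_ * _).
rewrite (eq_isum (h := fun c => h i a * \prod_(j <- s) h j (c j))).
  by rewrite isumZl IH.
by move=> c' cc'; rewrite big_cons cc' // upd_same.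
Qed.

Hypothesis th_ge0 : forall a, 0 <= th a.

Lemma isum_le s g h c :
  (forall c', (forall i, i \notin s -> c' i = c i) -> g c' <= h c') ->
  isum s g c <= isum s h c.
Proof.
elim: s c => [|i s IH] c gh /=; first exact: gh.
apply: ler_sum => a _; apply: ler_wpM2l => //; apply: IH => c' cc'.
apply: gh => j; rewrite inE negb_or => /andP[ji js].
by rewrite cc'// upd_other.
Qed.

Hypothesis th_sum1 : \sum_a th a = 1.

Lemma isum_ignores s g c : ignores s g -> isum s g c = g c.
Proof.
elim: s c => //= i s IH c ig.
rewrite (eq_bigr (fun a => th a * g c)).
  by rewrite -mulr_suml th_sum1 mul1r.
move=> a _; rewrite IH; last by apply: ignores_sub ig => j js; rewrite inE js orbT.
by congr (_ * _); apply: ig => j; rewrite inE negb_or => /andP[ji _]; rewrite upd_other.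
Qed.

Lemma isum_cst s (k : R) c : isum s (fun=> k) c = k.
Proof. exact: isum_ignores. Qed.

Lemma depends_isum_cat s t g c c' : depends s g ->
  isum (t ++ s) g c = isum s g c'.
Proof.
move=> dg; rewrite isum_cat isum_ignores; first exact: depends_isumT.
by move=> x y _; apply: depends_isumT.
Qed.

(* Expectation of a function of finitely many coordinates under the product of
   copies of [th]; junk value for other functions. *)
Context (a0 : A).

Definition support (g : (I -> A) -> R) : seq I :=
  if pselect (local g) is left lg then projT1 (cid lg) else [::].

Definition expect g : R := isum (support g) g (fun=> a0).

Lemma supportP g : local g -> depends (support g) g.
Proof. by move=> lg; rewrite /support; case: pselect => // h; case: cid. Qed.

Lemma expectE s g c : depends s g -> expect g = isum s g c.
Proof.
move=> dg; have dg' : depends (support g) g by apply: supportP; exists s.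
rewrite /expect -(depends_isum_cat s c _ dg') isum_cat.
by rewrite isumC -isum_cat (depends_isum_cat _ _ c dg).
Qed.

(** The tower property. Each one-step argument on the dynamics first averages over a short list [s],
    with everything else frozen. *)
Lemma expect_tower s g : local g -> expect g = expect (isum s g).
Proof.
move=> [t dg]; pose c : I -> A := fun=> a0.
have d1 : depends (s ++ t) g by apply: depends_sub dg => i it; rewrite mem_cat it orbT.
have d2 : depends t (isum s g) by apply: depends_isum.
by rewrite (expectE c d1) (expectE c d2) isum_cat isumC.
Qed.

Lemma le_expect g h : local g -> local h -> (forall c, g c <= h c) ->
  expect g <= expect h.
Proof.
move=> [s dg] [t dh] gh; pose c : I -> A := fun=> a0.
have d1 : depends (s ++ t) g by apply: depends_sub dg => i it; rewrite mem_cat it.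
have d2 : depends (s ++ t) h by apply: depends_sub dh => i it; rewrite mem_cat it orbT.
by rewrite (expectE c d1) (expectE c d2); apply: isum_le.
Qed.

Lemma expectD g h : local g -> local h ->
  expect (fun c => g c + h c) = expect g + expect h.
Proof.
move=> [s dg] [t dh]; pose c : I -> A := fun=> a0.
have d1 : depends (s ++ t) g by apply: depends_sub dg => i it; rewrite mem_cat it.
have d2 : depends (s ++ t) h by apply: depends_sub dh => i it; rewrite mem_cat it orbT.
rewrite (expectE c d1) (expectE c d2) -isumD; apply: expectE => x y xy.
by rewrite (d1 _ _ xy) (d2 _ _ xy).
Qed.

Lemma expectZ k g : local g -> expect (fun c => k * g c) = k * expect g.
Proof.
move=> [s dg]; pose c : I -> A := fun=> a0.
rewrite (expectE c dg) -isumZl; apply: expectE => x y xy.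
by rewrite (dg _ _ xy).
Qed.

Lemma expect_cst k : expect (fun=> k) = k.
Proof. by rewrite /expect isum_cst. Qed.

Lemma expect_sum (J : eqType) (r : seq J) (g : J -> (I -> A) -> R) :
  (forall j, local (g j)) ->
  expect (fun c => \sum_(j <- r) g j c) = \sum_(j <- r) expect (g j).
Proof.
move=> lg; elim: r => [|j r IH].
  by rewrite big_nil -[RHS](expect_cst 0); congr expect; apply/funext => c; rewrite big_nil.
rewrite big_cons -IH -expectD //.
  by congr expect; apply/funext => c; rewrite big_cons.
apply: (@local_seqP _ _ _ r g (fun f => \sum_(j <- r) f j)) => // f f' ff'.
exact: eq_big_seq.
Qed.

End IteratedSums.

(** * Maximal couplings and the Dobrushin coefficient *)

Section Coupling.
Context (R : realType) (S : finType).
Implicit Types (P : S -> R) (a b s : S).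

Definition is_law P := (forall s, 0 <= P s) /\ \sum_s P s = 1.

Lemma dTV_ge0 P1 P2 : 0 <= dTV P1 P2.
Proof. by rewrite mulr_ge0 ?invr_ge0 ?ler0n// sumr_ge0. Qed.

Lemma dTV_triangle P1 P2 P3 : dTV P1 P3 <= dTV P1 P2 + dTV P2 P3.
Proof.
rewrite /dTV -mulrDr -big_split /=; apply: ler_wpM2l; first by rewrite invr_ge0.
by apply: ler_sum => s _; exact: ler_distD.
Qed.

Lemma dTV_refl P : dTV P P = 0.
Proof. by rewrite /dTV big1 ?mulr0// => s _; rewrite subrr normr0. Qed.

Section MaximalCoupling.
Variables P P' : S -> R.

Definition keep_prob a : R := Num.min (P a) (P' a) / P a.

(** When the distance is 0 no mass has to move; the default [P'] keeps [coupling a] a law for every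
    [a], including those of [P]-mass 0, where [keep_prob a] is 0 by the convention on division. *)
Definition excess b : R :=
  if dTV P P' == 0 then P' b else (P' b - Num.min (P b) (P' b)) / dTV P P'.

(* If [a] has law [P], then moving from [a] to [b] with probability
   [coupling a b] yields law [P'] and changes [a] with probability at most
   [dTV P P']. *)
Definition coupling a b : R :=
  keep_prob a * (a == b)%:R + (1 - keep_prob a) * excess b.

Hypotheses (lP : is_law P) (lP' : is_law P').

Let P0 a : 0 <= P a. Proof. by case: lP. Qed.
Let P'0 a : 0 <= P' a. Proof. by case: lP'. Qed.

Lemma dTV_excessl : \sum_a (P a - Num.min (P a) (P' a)) = dTV P P'.
Proof.
have [_ sP] := lP; have [_ sP'] := lP'.
have E1 a : `|P a - P' a| = P a + P' a - 2 * Num.min (P a) (P' a).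
  rewrite /Num.min; case: ltP => h.
    by rewrite ltr0_norm ?subr_lt0//; ring.
  by rewrite ger0_norm ?subr_ge0//; ring.
have E : \sum_a `|P a - P' a| = \sum_a (P a + P' a - 2 * Num.min (P a) (P' a)).
  by apply: eq_bigr => a _; exact: E1.
by rewrite /dTV E !sumrB big_split /= sP sP' -mulr_sumr; field.
 Qed.

Lemma dTV_excessr : \sum_a (P' a - Num.min (P a) (P' a)) = dTV P P'.
Proof.
have [_ sP] := lP; have [_ sP'] := lP'.
by rewrite -dTV_excessl !sumrB sP sP'.
Qed.

Lemma excess_ge0 a : 0 <= P' a - Num.min (P a) (P' a).
Proof. by rewrite subr_ge0 ge_min lexx orbT. Qed.

Lemma keep_prob_mul a : P a * keep_prob a = Num.min (P a) (P' a).
Proof.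
rewrite /keep_prob; have [Pa|Pa] := eqVneq (P a) 0.
  by rewrite Pa mul0r; apply/esym/min_idPl.
by rewrite mulrC divfK.
Qed.

Lemma keep_prob_ge0 a : 0 <= keep_prob a.
Proof. by rewrite divr_ge0// le_min P0 P'0. Qed.

Lemma keep_prob_le1 a : keep_prob a <= 1.
Proof.
rewrite /keep_prob; have [Pa|Pa] := eqVneq (P a) 0.
  by rewrite Pa invr0 mulr0 ler01.
by rewrite ler_pdivrMr ?lt_def ?Pa//= mul1r ge_min lexx.
Qed.

Lemma excess_law : is_law excess.
Proof.
have [_ sP'] := lP'.
rewrite /excess; have [D0|D0] := eqVneq (dTV P P') 0; first by [].
split; first by move=> s; rewrite divr_ge0 ?dTV_ge0 ?excess_ge0.
by rewrite -mulr_suml dTV_excessr divff.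
Qed.

Lemma excess_mul b : dTV P P' * excess b = P' b - Num.min (P b) (P' b).
Proof.
rewrite /excess; have [D0|D0] := eqVneq (dTV P P') 0.
  rewrite D0 mul0r; move: D0; rewrite -dTV_excessr => /psumr_eq0P E.
  by rewrite E// => s _; exact: excess_ge0.
by rewrite mulrC divfK.
Qed.

Lemma coupling_law a : is_law (coupling a).
Proof.
have [e0 e1] := excess_law; split=> [s|].
  by rewrite addr_ge0// mulr_ge0 ?keep_prob_ge0 ?subr_ge0 ?keep_prob_le1.
rewrite big_split /= -!mulr_sumr e1 (bigD1 a)//= eqxx big1 => [|b /negbTE ab].
  by rewrite addr0 !mulr1 addrC subrK.
by rewrite eq_sym ab.
Qed.

Lemma coupling_marginal b : \sum_a P a * coupling a b = P' b.
Proof.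
rewrite (eq_bigr (fun a => P a * keep_prob a * (a == b)%:R
    + (P a - P a * keep_prob a) * excess b)); last first.
  by move=> a _; rewrite /coupling; ring.
rewrite big_split /= -mulr_suml.
under [X in _ + X * _]eq_bigr do rewrite keep_prob_mul.
rewrite dTV_excessl excess_mul (bigD1 b)//= eqxx keep_prob_mul mulr1 big1.
  by rewrite addr0 addrC subrK.
by move=> a /negbTE ->; rewrite mulr0.
Qed.

(** A change requires that [a] not be kept, and the mass of [P] that is not kept is the excess of
    [P] over the minimum, which sums to the distance. *)
Lemma coupling_neq : \sum_a P a * \sum_b coupling a b * (a != b)%:R <= dTV P P'.
Proof.
have [e0 e1] := excess_law.
rewrite -dTV_excessl; apply: ler_sum => a _.
rewrite -keep_prob_mul -[X in X - _]mulr1 -mulrBr; apply: ler_wpM2l => //.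
apply: (@le_trans _ _ (\sum_b (1 - keep_prob a) * excess b)).
  apply: ler_sum => b _; rewrite /coupling; case: eqVneq => /= _.
    by rewrite mulr0 mulr_ge0// subr_ge0 keep_prob_le1.
  by rewrite mulr0 add0r mulr1.
by rewrite -mulr_sumr e1 mulr1.
Qed.

End MaximalCoupling.
End Coupling.

Section ConditionalLaw.
Context (R : realType) (d : nat) (S : finType) (pi : S -> R) (Q : S -> S -> R).
Hypothesis hQ : reversible_chain pi Q.
Hypothesis hB : forall w : {ffun 'I_d -> S}, 0 < nbhd_prob pi Q w.
Implicit Types w : {ffun 'I_d -> S}.

Lemma nbhd_weight_ge0 w s : 0 <= nbhd_weight pi Q w s.
Proof.
by case: hQ => -[p0 _] [q0 _] _; apply: mulr_ge0 => //; apply: prodr_ge0.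
Qed.

Lemma cond_law_is_law w : is_law (cond_law pi Q w).
Proof.
split=> [s|]; first by rewrite divr_ge0 ?nbhd_weight_ge0// ltW.
by rewrite /cond_law -mulr_suml -/(nbhd_prob pi Q w) divff// gt_eqF.
Qed.

Lemma cond_law_perm (f : 'I_d -> 'I_d) w : injective f ->
  cond_law pi Q [ffun i => w (f i)] = cond_law pi Q w.
Proof.
move=> fi; have E : nbhd_weight pi Q [ffun i => w (f i)] = nbhd_weight pi Q w.
  apply/funext => s; rewrite /nbhd_weight; congr (_ * _).
  under eq_bigr do rewrite ffunE.
  by rewrite [RHS](reindex f)//; exact: onW_bij (injF_bij fi).
by apply/funext => s; rewrite /cond_law /nbhd_prob E.
Qed.

Lemma dobrushin_ub w w' : #|[set i | w i != w' i]%SET| = 1%N ->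
  dTV (cond_law pi Q w) (cond_law pi Q w') <= dobrushin d pi Q.
Proof.
move=> ww'; apply: ub_le_sup; last by exists w, w'.
exists (\sum_(u : {ffun 'I_d -> S}) \sum_(u' : {ffun 'I_d -> S})
  dTV (cond_law pi Q u) (cond_law pi Q u')).
move=> _ [u [u' [_ ->]]].
rewrite (bigD1 u)//= (bigD1 u')//= -addrA ler_wpDr// addr_ge0// sumr_ge0// => v _.
  exact: dTV_ge0.
by apply: sumr_ge0 => v' _; exact: dTV_ge0.
Qed.

Lemma dobrushin_ge0 : 0 <= dobrushin d pi Q.
Proof.
rewrite /dobrushin; set E := (X in sup X).
have [->|/set0P[r Er]] := eqVneq E set0; first by rewrite sup0.
have [w [w' [ww' _]]] := Er.
by apply: le_trans (dobrushin_ub ww'); exact: dTV_ge0.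
Qed.

(** Path coupling: change [w] into [w'] one neighbour at a time and add up the distances by the
    triangle inequality. *)
Lemma dTV_dobrushin w w' : dTV (cond_law pi Q w) (cond_law pi Q w')
  <= dobrushin d pi Q * \sum_i (w i != w' i)%:R.
Proof.
have -> : \sum_i (w i != w' i)%:R = #|[set i | w i != w' i]%SET|%:R :> R.
  rewrite -sum1_card natr_sum [LHS](bigID (fun i => w i != w' i))/=.
  rewrite [X in _ + X]big1 => [|i /negPn/eqP ->]; last by rewrite eqxx.
  rewrite addr0; apply: eq_big => [i|i ->] //; by rewrite inE.
move En: #|_| => n; elim: n w En => [|n IH] w En.
  have -> : w = w'.
    apply/ffunP => i; apply/eqP/negPn; move: En => /eqP; rewrite cards_eq0 => /eqP/setP/(_ i).
    by rewrite !inE => ->.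
  by rewrite dTV_refl mulr0.
have /card_gt0P[i] : (0 < #|[set i | w i != w' i]%SET|)%N by rewrite En.
rewrite inE => wi.
pose v : {ffun 'I_d -> S} := [ffun j => if j == i then w' j else w j].
have E1 : [set j | w j != v j]%SET = [set i]%SET.
  apply/setP => j; rewrite !inE ffunE; case: (eqVneq j i) => [->|_]; first by rewrite wi.
  by rewrite eqxx.
have E2 : #|[set j | v j != w' j]%SET| = n.
  have -> : [set j | v j != w' j]%SET = ([set j | w j != w' j] :\ i)%SET.
    by apply/setP => j; rewrite !inE ffunE; case: (eqVneq j i) => [->|_] //=; rewrite eqxx.
  by move: En; rewrite (cardsD1 i) inE wi add1n => -[].
apply: le_trans (dTV_triangle _ (cond_law pi Q v) _) _.
rewrite mulrSr mulrDr mulr1 addrC; apply: lerD; first exact: IH.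
by apply: dobrushin_ub; rewrite E1 cards1.
Qed.

End ConditionalLaw.

(** * The tree and the cylinder weights *)

Section MoreIteratedSums.
Context (I : choiceType) (A : finType) (R : realFieldType).

Definition sum_over (s : seq I) (g : (I -> A) -> R) (c : I -> A) : R :=
  isum (fun=> 1) s g c.

(** Only the term that agrees with [y] on [s] survives the indicator. Read backwards, this expands a
    function of [y] over the cylinders on [s]. *)
Lemma sum_over_patch (s : seq I) (y x : I -> A) (h : (I -> A) -> R) : uniq s ->
  sum_over s (fun x => (all (fun v => y v == x v) s)%:R * h x) x
  = h (fun v => if v \in s then y v else x v).
Proof.
rewrite /sum_over; elim: s x h => [|v s IH] x h /=; first by rewrite mul1r.
move=> /andP[vs us]; rewrite (bigD1 (y v))//= big1 ?addr0 => [|a /negbTE ay].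
  rewrite mul1r (eq_isum _ (h := fun x => (all (fun v => y v == x v) s)%:R * h x)).
    rewrite IH//; congr h; apply/funext => w; rewrite inE.
    by rewrite /upd; case: eqVneq => // ->; rewrite (negbTE vs).
  by move=> c cc; rewrite cc// upd_same eqxx.
rewrite mul1r (eq_isum _ (h := fun=> 0)).
  rewrite -[fun=> 0](_ : (fun c : I -> A => 0 * h c) = _) ?isumZl ?mul0r//.
  by apply/funext => c; rewrite mul0r.
by move=> c cc; rewrite cc// upd_same eq_sym ay mul0r.
Qed.

(** The summations commute, so that over [u] can be made the innermost one; this reduces global
    invariance to an identity at one site. *)
Lemma eq_sum_over_site (s : seq I) u (g h : (I -> A) -> R) x : u \in s ->
  (forall x, \sum_a g (upd x u a) = \sum_a h (upd x u a)) ->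
  sum_over s g x = sum_over s h x.
Proof.
case/splitPr=> p1 p2 gh; rewrite /sum_over -cat1s !isum_cat.
congr isum; apply/funext => c; rewrite !isum_cat !(isumC _ [:: u]).
congr isum; apply/funext => c' /=.
by under eq_bigr do rewrite mul1r; rewrite gh; apply: eq_bigr => a _; rewrite mul1r.
Qed.

End MoreIteratedSums.

Section ExpectSum.
Context (I J : choiceType) (A B : finType) (R : realFieldType) (th : A -> R) (a0 : A).
Hypotheses (th_ge0 : forall a, 0 <= th a) (th_sum1 : \sum_a th a = 1).

Lemma local_sum_over (s : seq J) (h : (I -> A) -> (J -> B) -> R) x :
  (forall x, local (h ^~ x)) -> local (fun c => sum_over s (h c) x).
Proof.
move=> lh; rewrite /sum_over; elim: s x => [|j s IH] x //=.
by apply: (local_fin (g := fun b c => isum (fun=> 1) s (h c) (upd x j b))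
  (fun f => \sum_b 1 * f b)).
Qed.

Lemma expect_sum_over (s : seq J) (h : (I -> A) -> (J -> B) -> R) x :
  (forall x, local (h ^~ x)) ->
  expect th a0 (fun c => sum_over s (h c) x)
  = sum_over s (fun x => expect th a0 (h ^~ x)) x.
Proof.
move=> lh; rewrite /sum_over; elim: s x => [|j s IH] x //=.
under [RHS]eq_bigr => b _ do rewrite -IH mul1r.
rewrite -expect_sum//; last by move=> b; exact: local_sum_over.
by congr expect; apply/funext => c; apply: eq_bigr => b _; rewrite mul1r.
Qed.

End ExpectSum.

Section Tree.
Context (d : nat).
Implicit Types (u v : vertex d) (i : 'I_d).

Lemma step_parent i u : ohead (word u) = Some i -> step i u = parent u.
Proof. by move=> h; apply: val_inj; rewrite /= /step_word h eqxx. Qed.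

Lemma step_child i u : ohead (word u) != Some i ->
  parent (step i u) = u /\ step i u != root d.
Proof.
move=> /negbTE h; split; first by apply: val_inj; rewrite /= /step_word h.
by apply/eqP => /(congr1 (@word d)); rewrite /= /step_word h.
Qed.

Lemma vertex_head u : u != root d -> exists i, ohead (word u) = Some i.
Proof.
case: u => -[|i w] rw; last by exists i.
by case/negP; apply/eqP/val_inj.
Qed.

Lemma size_parent u : size (word (parent u)) = (size (word u)).-1.
Proof. by rewrite /= size_behead. Qed.

Lemma size_vertex_eq0 u : (size (word u) == 0)%N = (u == root d).
Proof.
rewrite size_eq0; apply/eqP/eqP => [h|->] //; exact: val_inj.
Qed.

Lemma step_neq i u : step i u != u.
Proof.
apply/eqP => /(congr1 (fun v => size (word v))) /=.
rewrite /step_word; case: ifP => [|_] /=; last by move/esym/n_Sn.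
by case: (word u) => //= j w _ /n_Sn.
Qed.

Lemma parent_child u v : v != root d -> parent v = u ->
  exists2 i, ohead (word u) != Some i & v = step i u.
Proof.
move=> v0 vu; have [i hi] := vertex_head v0; exists i.
  rewrite -vu /=; case: v hi {v0 vu} => -[|j w] //= rw [<-].
  by case: w rw => //= k w; rewrite /reduced /= => /andP[jk _]; apply: contraNneq jk => -[->].
by rewrite -vu -(step_parent hi) stepK.
Qed.

Lemma parent_neq u : u != root d -> parent u != u.
Proof. by move=> /vertex_head[i hi]; rewrite -(step_parent hi) step_neq. Qed.

Definition tree_closed (F : {fset vertex d}) :=
  root d \in F /\ forall v, v \in F -> parent v \in F.

(** It suffices to add all ancestors. Cylinder probabilities are prescribed only on such sets, so
    every finite set of vertices is first enlarged to one. *)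
Lemma tree_closure (s : seq (vertex d)) :
  exists2 F : {fset vertex d}, tree_closed F & {subset s <= F}.
Proof.
have iter_root v : iter (size (word v)) (@parent d) v = root d.
  apply/eqP; rewrite -size_vertex_eq0.
  suff /(_ (size (word v))) -> : forall k,
      size (word (iter k (@parent d) v)) = (size (word v) - k)%N.
    by rewrite subnn.
  by elim=> [|k IH]; rewrite ?subn0// iterS size_parent IH subnS.
pose anc v := [seq iter k (@parent d) v | k <- iota 0 (size (word v)).+1].
exists [fset v in root d :: flatten (map anc s)]%fset.
  split=> [|v]; first by rewrite !inE eqxx.
  rewrite !inE => /predU1P[->|/flattenP[l /mapP[w ws ->] /mapP[k]]].
    by apply/orP; left; apply/eqP/val_inj.
  rewrite mem_iota /= add0n ltnS leq_eqVlt => /predU1P[-> ->|kw ->].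
    by rewrite iter_root; apply/orP; left; apply/eqP/val_inj.
  apply/orP; right; apply/flattenP; exists (anc w); first exact: map_f.
  by apply/mapP; exists k.+1 => //; rewrite mem_iota.
move=> v vs; rewrite !inE; apply/orP; right; apply/flattenP.
by exists (anc v); [exact: map_f|apply/mapP; exists 0%N].
Qed.

Definition nbr (S : Type) (x : vertex d -> S) v : {ffun 'I_d -> S} :=
  [ffun i => x (step i v)].

End Tree.

Section CylinderWeight.
Context (R : realType) (d : nat) (S : finType) (pi : S -> R) (Q : S -> S -> R).
Hypothesis hQ : reversible_chain pi Q.
Hypothesis hB : forall w : {ffun 'I_d -> S}, 0 < nbhd_prob pi Q w.
Implicit Types (x : vertex d -> S) (u v : vertex d) (F : {fset vertex d}).

Definition cylinder_weight F x : R :=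
  pi (x (root d)) * \prod_(v <- F | v != root d) Q (x (parent v)) (x v).

Definition nbr_closed F u := u \in F /\ forall i, step i u \in F.

Lemma prod_children F u (f : vertex d -> R) : nbr_closed F u ->
  \prod_(v <- F | (v != root d) && (parent v == u)) f v
  = \prod_(i | ohead (word u) != Some i) f (step i u).
Proof.
move=> [uF nF]; rewrite -big_filter -[RHS]big_filter.
rewrite -[RHS](big_map (fun i => step i u) xpredT f) /=.
apply: perm_big; apply: uniq_perm; first by rewrite filter_uniq// fset_uniq.
  by rewrite map_inj_uniq ?filter_uniq ?index_enum_uniq//; exact: step_inj.
move=> v; rewrite mem_filter; apply/andP/mapP.
  move=> [/andP[v0 /eqP vu] vF]; have [i hi ->] := parent_child v0 vu.
  by exists i => //; rewrite mem_filter hi mem_index_enum.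
move=> [i]; rewrite mem_filter => /andP[hi _] ->.
have [-> ->] := step_child hi; rewrite eqxx; split=> //; exact: nF.
Qed.

Let children x u a := \prod_(i | ohead (word u) != Some i) Q a (x (step i u)).

Lemma cylinder_weight_root F x u : tree_closed F -> nbr_closed F u -> u = root d ->
  exists C, forall a, cylinder_weight F (upd x u a) = C * (pi a * children x u a).
Proof.
move=> cF nF u0; subst u.
exists (\prod_(v <- F | (v != root d) && (parent v != root d)) Q (x (parent v)) (x v)) => a.
rewrite mulrC -mulrA /cylinder_weight upd_same; congr (_ * _).
rewrite (bigID (fun v => parent v == root d))/=; congr (_ * _).
  by rewrite prod_children.
by apply: eq_bigr => v /andP[vu pv]; rewrite !upd_other.
Qed.

Lemma cylinder_weight_nonroot F x u : tree_closed F -> nbr_closed F u -> u != root d ->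
  exists C, forall a, cylinder_weight F (upd x u a)
    = C * (Q (x (parent u)) a * children x u a).
Proof.
move=> cF nF u0.
exists (pi (x (root d)) * \prod_(v <- F | [&& v != root d, parent v != u & v != u])
  Q (x (parent v)) (x v)) => a.
rewrite /cylinder_weight upd_other ?(eq_sym (root d))// -mulrA; congr (_ * _).
rewrite (bigID (fun v => parent v == u))/= prod_children//.
rewrite [X in X * _ = _](_ : _ = children x u a); last first.
  apply: eq_bigr => i hi.
  by have [E _] := step_child hi; rewrite E upd_same upd_other// step_neq.
rewrite (bigID (pred1 u))/= -[X in _ * (X * _) = _]big_filter.
rewrite (_ : [seq v <- F | (v != root d) && (parent v != u) && (v == u)] = [:: u]).
  rewrite big_seq1 upd_same upd_other ?parent_neq//.
  rewrite [X in _ * (_ * X) = _](_ : _ =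
    \prod_(v <- F | [&& v != root d, parent v != u & v != u]) Q (x (parent v)) (x v)).
    by ring.
  apply: eq_big => [v|v]; first by rewrite andbA.
  by move=> /andP[/andP[_ pv] vu]; rewrite !upd_other.
rewrite (eq_filter (a2 := pred1 u)) => [|v /=].
  by rewrite filter_pred1_uniq ?fset_uniq//; case: nF.
by case: (eqVneq v u) => [->|_]; rewrite ?andbF// u0 parent_neq.
Qed.

Lemma nbhd_weight_root x u s : u = root d ->
  nbhd_weight pi Q (nbr x u) s = pi s * children x u s.
Proof.
move=> u0; rewrite /nbhd_weight /children u0; congr (_ * _).
by apply: eq_bigr => i _; rewrite ffunE.
Qed.

(** Reversibility turns around the edge from [u] to its parent: the weight centred at [u] becomes
    the one obtained by sampling outward from the root. *)
Lemma nbhd_weight_nonroot x u s : u != root d ->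
  nbhd_weight pi Q (nbr x u) s = pi (x (parent u)) * (Q (x (parent u)) s * children x u s).
Proof.
move=> /vertex_head[i hi]; have [_ _ rev] := hQ.
rewrite mulrA -rev -mulrA; congr (_ * _).
rewrite (bigD1 i)//= ffunE (step_parent hi); congr (_ * _).
apply: eq_big => [j|j _]; last by rewrite ffunE.
by rewrite hi eq_sym.
Qed.

(* By reversibility, the weight of a cylinder is, as a function of the state of
   [u] alone, proportional to [nbhd_weight]. *)
Lemma detailed_balance F x u a s : tree_closed F -> nbr_closed F u ->
  cylinder_weight F (upd x u a) * nbhd_weight pi Q (nbr x u) s
  = cylinder_weight F (upd x u s) * nbhd_weight pi Q (nbr x u) a.
Proof.
move=> cF nF; have [u0|u0] := eqVneq u (root d).
  have [C CE] := cylinder_weight_root x cF nF u0.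
  by rewrite !CE !nbhd_weight_root//; ring.
have [C CE] := cylinder_weight_nonroot x cF nF u0.
by rewrite !CE !nbhd_weight_nonroot//; ring.
Qed.

(** The heat-bath (Gibbs sampler) operator at the single site [u]. *)
Definition resample u (g : (vertex d -> S) -> R) x : R :=
  \sum_s cond_law pi Q (nbr x u) s * g (upd x u s).

Lemma nbr_upd x u a : nbr (upd x u a) u = nbr x u.
Proof. by apply/ffunP => i; rewrite !ffunE upd_other// step_neq. Qed.

(** Sum over the old state [a] of [u] only. Detailed balance exchanges [a] with the new state [s];
    the remaining sum of [nbhd_weight] over [a] then cancels the normalisation of [cond_law]. *)
Lemma resample_invariant F u g x : tree_closed F -> nbr_closed F u ->
  sum_over F (fun x => cylinder_weight F x * resample u g x) x
  = sum_over F (fun x => cylinder_weight F x * g x) x.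
Proof.
move=> cF nF; apply: (eq_sum_over_site (u := u)) => [|{}x]; first by case: nF.
rewrite /resample; under eq_bigr => a _ do rewrite mulr_sumr.
rewrite exchange_big /=; apply: eq_bigr => s _.
have E a : cylinder_weight F (upd x u a) * (cond_law pi Q (nbr (upd x u a) u) s
      * g (upd (upd x u a) u s))
    = cylinder_weight F (upd x u s) * g (upd x u s)
      / nbhd_prob pi Q (nbr x u) * nbhd_weight pi Q (nbr x u) a.
  by rewrite nbr_upd upd_upd /cond_law 2!mulrA detailed_balance//; ring.
under eq_bigr do rewrite E.
by rewrite -mulr_sumr -/(nbhd_prob pi Q (nbr x u)) divfK// gt_eqF.
Qed.

End CylinderWeight.

(** * Sampling the branching Markov process *)

Section Requests.
Context (R : realType) (d : nat) (S : finType) (pi : S -> R) (Q : S -> S -> R).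

(** Which law a coordinate must sample from depends on the past of the dynamics. A noise value
    therefore answers all the finitely many possible requests in advance, which keeps it independent
    of that past. *)
Definition request : Type :=
  (option S + {ffun 'I_d -> S}
   + {ffun 'I_d -> S} * {ffun 'I_d -> S} * S)%type.

HB.instance Definition _ := Finite.on request.

Definition ask_stationary : request := inl (inl None).
Definition ask_transition (a : S) : request := inl (inl (Some a)).
Definition ask_update (w : {ffun 'I_d -> S}) : request := inl (inr w).
Definition ask_coupled (w w' : {ffun 'I_d -> S}) (a : S) : request := inr (w, w', a).

Definition request_law (r : request) : S -> R :=
  match r with
  | inl (inl None) => pi
  | inl (inl (Some a)) => Q a
  | inl (inr w) => cond_law pi Q w
  | inr (w, w', a) => coupling (cond_law pi Q w) (cond_law pi Q w') a
  end.

Lemma request_law_is_law (r : request) : reversible_chain pi Q ->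
  (forall w : {ffun 'I_d -> S}, 0 < nbhd_prob pi Q w) -> is_law (request_law r).
Proof.
move=> hQ hB; have [hp [q0 q1] _] := hQ.
case: r => [[[a|]|w]|[[w w'] a]] //=; first exact: cond_law_is_law.
by apply: coupling_law; exact: cond_law_is_law.
Qed.

Definition noise : Type := (bool * {ffun request -> S})%type.

HB.instance Definition _ := Finite.on noise.

Definition answer (phi : noise) (r : request) : S := phi.2 r.

(* [((m, j), v)] indexes the noise used at the vertex [v] at time [m]: the bit of
   layer 0 decides which vertices are resampled at time [m], layer 1 at time 0
   samples the branching Markov process, and layer [k + 2] draws the innovation
   of the [k]-th trajectory given that of the previous one. *)
Definition coordinate : Type := ((nat * nat) * vertex d)%type.

HB.instance Definition _ := Countable.on coordinate.

End Requests.

Section StationaryProcess.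
Context (R : realType) (d : nat) (S : finType) (pi : S -> R) (Q : S -> S -> R).
Hypothesis hQ : reversible_chain pi Q.
Hypothesis hB : forall w : {ffun 'I_d -> S}, 0 < nbhd_prob pi Q w.
Local Notation noise := (noise d S).
Local Notation coordinate := (coordinate d).
Context (th : noise -> R) (a0 : noise).
Hypothesis th_ge0 : forall phi, 0 <= th phi.
Hypothesis th_sum1 : \sum_phi th phi = 1.
Hypothesis th_answer : forall r s,
  \sum_phi th phi * (answer phi r == s)%:R = request_law pi Q r s.
Implicit Types (c : coordinate -> noise) (x : vertex d -> S) (u v : vertex d).

Local Notation E := (expect th a0).

Lemma sum_answer r (G : S -> R) :
  \sum_phi th phi * G (answer phi r) = \sum_s request_law pi Q r s * G s.
Proof.
under [RHS]eq_bigr => s _ do rewrite -th_answer mulr_suml.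
rewrite exchange_big /=; apply: eq_bigr => phi _.
rewrite (bigD1 (answer phi r))//= eqxx mulr1 big1 ?addr0// => s /negbTE hs.
by rewrite eq_sym hs mulr0 mul0r.
Qed.

Definition source v : coordinate := ((0, 1)%N, v).

Fixpoint branch_rec c n v : S :=
  answer (c (source v))
    (if n is n'.+1 then ask_transition d (branch_rec c n' (parent v))
     else ask_stationary d S).

Definition branch c v : S := branch_rec c (size (word v)) v.

Lemma branch_root c : branch c (root d) = answer (c (source (root d))) (ask_stationary d S).
Proof. by []. Qed.

Lemma branch_nonroot c v : v != root d ->
  branch c v = answer (c (source v)) (ask_transition d (branch c (parent v))).
Proof.
rewrite -size_vertex_eq0 /branch size_parent.
by case: (size (word v)) => //= n _.
Qed.

Lemma branch_depends (F : seq (vertex d)) : exists2 Y : seq coordinate,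
  {in Y, forall i, exists v, i = source v} &
  forall c c', {in Y, c =1 c'} -> {in F, branch c =1 branch c'}.
Proof.
elim: F => [|v F [Y Y1 dY]]; first by exists [::].
have [Z Z1 dZ] : exists2 Z : seq coordinate, {in Z, forall i, exists v, i = source v} &
    forall c c', {in Z, c =1 c'} -> branch c v = branch c' v.
  rewrite /branch; move: (size _) => n; elim: n v => [|n IH] w.
    exists [:: source w] => [i|c c' cc' /=]; first by rewrite inE => /eqP ->; exists w.
    by rewrite cc'// inE.
  have [Z Z1 dZ] := IH (parent w).
  exists (source w :: Z) => [i|c c' cc' /=].
    by rewrite inE => /predU1P[->|/Z1//]; exists w.
  rewrite cc' ?inE ?eqxx// (dZ c c')// => i iZ.
  by apply: cc'; rewrite inE iZ orbT.
exists (Y ++ Z) => [i|c c' cc' w].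
  by rewrite mem_cat => /orP[/Y1|/Z1].
rewrite inE => /predU1P[->|wF].
  by apply: dZ => i iZ; apply: cc'; rewrite mem_cat iZ orbT.
by apply: dY wF => i iY; apply: cc'; rewrite mem_cat iY.
Qed.

Lemma branch_depends_source c c' :
  (forall i, i.1.2 = 1%N -> c i = c' i) -> branch c = branch c'.
Proof.
move=> cc'; apply/funext => v; have [Y Y1 dY] := branch_depends [:: v].
by apply: dY; rewrite ?inE// => i /Y1[w ->]; exact: cc'.
Qed.

Lemma local_branch v : local (fun c => branch c v).
Proof.
have [Y _ dY] := branch_depends [:: v].
by exists Y => c c' cc'; apply: dY => //; rewrite inE.
Qed.

Definition source_request x v : request d S :=
  if v == root d then ask_stationary d S else ask_transition d (x (parent v)).

(** As long as the colours follow [x], the request made at [v] is the deterministic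
    [source_request x v]. The adaptive event thus becomes a conjunction of conditions on distinct
    coordinates, whose probability is a product. *)
Lemma branch_cylinder (F : {fset vertex d}) c x : tree_closed F ->
  all (fun v => branch c v == x v) F
  = all (fun v => answer (c (source v)) (source_request x v) == x v) F.
Proof.
move=> [rF pF]; apply/allP/allP => h v vF.
  have := h v vF; rewrite /source_request; have [->|v0] := eqVneq v (root d).
    by rewrite branch_root.
  by rewrite branch_nonroot// (eqP (h _ (pF v vF))).
have [n] := ubnP (size (word v)); elim: n v vF => // n IH v vF; rewrite ltnS => vn.
have := h v vF; rewrite /source_request; have [->|v0] := eqVneq v (root d).
  by rewrite branch_root.
rewrite branch_nonroot// (eqP (IH (parent v) (pF v vF) _))//.
rewrite size_parent; move: v0 vn; rewrite -size_vertex_eq0.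
by case: (size _) => //= k _.
Qed.

Lemma branch_cylinder_expect (F : {fset vertex d}) x : tree_closed F ->
  E (fun c => (all (fun v => branch c v == x v) F)%:R) = cylinder_weight pi Q F x.
Proof.
move=> cF; pose s := [seq source v | v <- F].
pose h (i : coordinate) (phi : noise) : R := (answer phi (source_request x i.2) == x i.2)%:R.
have -> : (fun c => (all (fun v => branch c v == x v) F)%:R)
    = (fun c => \prod_(i <- s) h i (c i)) :> (_ -> R).
  apply/funext => c; rewrite branch_cylinder// big_map {cF s}.
  elim: (enum_fset F) => [|v r IH] /=; first by rewrite big_nil.
  by rewrite big_cons -IH -natrM mulnb.
rewrite (expectE th_sum1 a0 (s := s) (fun=> a0)); last first.
  by move=> c c' cc'; apply: eq_big_seq => i /cc' ->.
rewrite isum_uniq_prod; last first.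
  by rewrite map_inj_uniq ?fset_uniq// => u v [].
rewrite big_map /cylinder_weight; under eq_bigr do rewrite th_answer.
rewrite (bigD1_seq (root d))/= ?fset_uniq//; last by case: cF.
rewrite /source_request /source /= ?eqxx; congr (_ * _).
by apply: eq_bigr => v /negbTE ->.
Qed.

Lemma expect_branch (F : {fset vertex d}) (g : (vertex d -> S) -> R) x :
  tree_closed F -> depends F g ->
  E (fun c => g (branch c)) = sum_over F (fun x => cylinder_weight pi Q F x * g x) x.
Proof.
move=> cF dg.
have -> : (fun c => g (branch c)) = (fun c => sum_over F
    (fun x => (all (fun v => branch c v == x v) F)%:R * g x) x).
  apply/funext => c; rewrite sum_over_patch ?fset_uniq//.
  by apply: dg => v vF; rewrite vF.
have lc z : local (fun c => (all (fun v => branch c v == z v) F)%:R : R).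
  apply: (local_seqP (r := F) (h := fun f => (all (fun v => f v == z v) F)%:R)
    (g := fun v c => branch c v)) => [v|f f' ff']; first exact: local_branch.
  by congr (nat_of_bool _)%:R; apply: eq_in_all => v vF; rewrite ff'.
rewrite expect_sum_over//; last first.
  by move=> z; apply: (local_comp (fun t => t * g z)).
congr sum_over; apply/funext => z; rewrite -branch_cylinder_expect//.
rewrite mulrC -expectZ//; congr expect; apply/funext => c; exact: mulrC.
Qed.

Lemma depends_resample (F : seq (vertex d)) u (g : (vertex d -> S) -> R) :
  depends F g -> depends (F ++ [seq step i u | i : 'I_d]) (resample pi Q u g).
Proof.
move=> dg x x' xx'; rewrite /resample; have -> : nbr x u = nbr x' u.
  apply/ffunP => i; rewrite !ffunE; apply: xx'; rewrite mem_cat.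
  by apply/orP; right; apply: map_f; rewrite mem_enum.
apply: eq_bigr => s _; congr (_ * _); apply: dg => v vF; rewrite /upd.
by case: ifP => // _; apply: xx'; rewrite mem_cat vF.
Qed.

Lemma branch_resample u (g : (vertex d -> S) -> R) : local g ->
  E (fun c => resample pi Q u g (branch c)) = E (fun c => g (branch c)).
Proof.
move=> [G dg]; have [F cF GF] := tree_closure (u :: G ++ [seq step i u | i : 'I_d]).
have dgF : depends F g.
  by apply: depends_sub dg => v vG; apply: GF; rewrite inE mem_cat vG !orbT.
have drF : depends F (resample pi Q u g).
  apply: depends_sub (depends_resample (u := u) dg) => v vG.
  by apply: GF; rewrite inE vG orbT.
rewrite (expect_branch (fun=> answer a0 (ask_stationary d S)) cF drF).
rewrite (expect_branch (fun=> answer a0 (ask_stationary d S)) cF dgF).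
apply: resample_invariant => //; split; first by apply: GF; rewrite inE eqxx.
move=> i; apply: GF; rewrite inE mem_cat.
by apply/orP; right; apply/orP; right; apply: map_f; rewrite mem_enum.
Qed.

End StationaryProcess.

(** * Coupled Glauber dynamics *)

Section GlauberDynamics.
Context (d : nat) (S : finType).
Local Notation noise := (noise d S).
Local Notation coordinate := (coordinate d).
Implicit Types (c : coordinate -> noise) (u v : vertex d).

Definition bit c m v : bool := (c ((m, 0)%N, v)).1.

Definition active c m v : bool :=
  bit c m v && [forall i, ~~ bit c m (step i v)].

Lemma active_step c m v i : active c m v -> active c m (step i v) = false.
Proof. by move=> /andP[_ /forallP/(_ i)/negbTE h]; rewrite /active h. Qed.

(* Time runs backwards: [state c m] is computed from [state c m.+1]. *)
Record layer := Layer {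
  state : (coordinate -> noise) -> nat -> vertex d -> S;
  innov : (coordinate -> noise) -> nat -> vertex d -> S }.

(** This trajectory stays constant, but it still carries innovations with the right conditional law,
    so that the next trajectory has something to be coupled to. *)
Definition base_layer (s0 : S) : layer :=
  Layer (fun _ _ _ => s0)
    (fun c m v => answer (c ((m, 2)%N, v)) (ask_update (nbr (fun=> s0) v))).

Section NextLayer.
Variables (L : layer) (K : nat) (z0 : (coordinate -> noise) -> vertex d -> S) (j : nat).

Definition coupled_innov c m v (x : vertex d -> S) : S :=
  answer (c ((m, j), v))
    (ask_coupled (nbr (state L c m.+1) v) (nbr x v) (innov L c m v)).

(** The start [z0] is a parameter because the same coupling serves twice: from a constant for the
    successive [W_k], and from [branch] for the comparison with the stationary law. After [n] steps
    the time is [K - n]. *)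
Fixpoint run c n : vertex d -> S :=
  if n is n'.+1 then
    fun v => if active c (K - n) v then coupled_innov c (K - n) v (run c n')
             else run c n' v
  else z0 c.

Definition next_layer : layer :=
  Layer (fun c m => run c (K - m))
    (fun c m v => coupled_innov c m v (run c (K - m.+1))).

Lemma next_layer_init c m : (K <= m)%N -> state next_layer c m = z0 c.
Proof. by rewrite -subn_eq0 /= => /eqP ->. Qed.

Lemma next_layer_step c m v : (m < K)%N -> state next_layer c m v =
  if active c m v then innov next_layer c m v else state next_layer c m.+1 v.
Proof. by move=> mK; rewrite /= -(subnSK mK) /= subnSK// subKn// ltnW. Qed.

End NextLayer.

(* Layer [k] is the trajectory started [k] time steps before time [0]. *)
Fixpoint nth_layer (s0 : S) k : layer :=
  if k is k'.+1 then next_layer (nth_layer s0 k') k (fun _ _ => s0) k'.+3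
  else base_layer s0.

Definition steps_until (L : layer) M := forall c m v, (m < M)%N ->
  state L c m v = if active c m v then innov L c m v else state L c m.+1 v.

Lemma next_layer_steps L K z0 j : steps_until (next_layer L K z0 j) K.
Proof. by move=> c m v; exact: next_layer_step. Qed.

Lemma nth_layer_steps s0 k : steps_until (nth_layer s0 k) k.
Proof. by case: k => // k; exact: next_layer_steps. Qed.

(** As time indices grow towards the past, these are the coordinates already revealed once time [m]
    has been played. Layer 1 always belongs to them: it provides the start of the comparison
    trajectory although it is stored at time 0. *)
Definition future m (i : coordinate) : bool := (m <= i.1.1)%N || (i.1.2 == 1)%N.

Lemma futureW m i : future m.+1 i -> future m i.
Proof. by rewrite /future => /orP[/ltnW ->|->]; rewrite ?orbT. Qed.

(** The fresh noise behind one innovation: it is drawn given the innovation of the previous layer,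
    which is drawn given the one before, and so on down to layer 2. *)
Definition chain m v J : seq coordinate := [seq ((m, j), v) | j <- iota 2 J].

Lemma chainP m v J i :
  (i \in chain m v J) = [&& i.1.1 == m, (1 < i.1.2 < J.+2)%N & i.2 == v].
Proof.
case: i => -[m' j] v' /=; apply/mapP/and3P => [[k]|[/eqP -> jJ /eqP ->]].
  by rewrite mem_iota addSn => jJ [-> -> ->].
by exists j => //; rewrite mem_iota.
Qed.

Lemma chain_future m v J i : i \in chain m v J -> future m.+1 i = false.
Proof.
rewrite chainP /future => /and3P[/eqP -> /andP[j1 _] _].
by rewrite ltnn/= gtn_eqF.
Qed.

Lemma chain_future_up m v J i : i \in chain m v J -> future m i.
Proof. by rewrite chainP /future => /and3P[/eqP -> _ _]; rewrite leqnn. Qed.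

Lemma chainS m v J : chain m v J.+1 = chain m v J ++ [:: ((m, J.+2), v)].
Proof. by rewrite /chain -{1}(addn1 J) iotaD map_cat add2n. Qed.

Lemma active_agree c c' m v : (forall u, c ((m, 0)%N, u) = c' ((m, 0)%N, u)) ->
  active c m v = active c' m v.
Proof.
move=> cc'; rewrite /active /bit cc'; congr (_ && _).
by apply: eq_forallb => i; rewrite cc'.
Qed.

Lemma local_active m v : local (fun c => active c m v).
Proof.
apply: (local_comp2 andb).
  by apply: (local_comp (fun phi : noise => phi.1)); exact: local_coord.
apply: (local_fin (g := fun i c => bit c m (step i v)) (fun f => [forall i, ~~ f i])) => i.
by apply: (local_comp (fun phi : noise => phi.1)); exact: local_coord.
Qed.

Lemma local_nbr (x : (coordinate -> noise) -> vertex d -> S) v :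
  (forall u, local (fun c => x c u)) -> local (fun c => nbr (x c) v).
Proof.
by move=> lx; apply: (local_fin (g := fun i c => x c (step i v)) (fun f => [ffun i => f i])).
Qed.

End GlauberDynamics.

Section GoodLayers.
Context (R : realType) (d : nat) (S : finType) (pi : S -> R) (Q : S -> S -> R).
Hypothesis hQ : reversible_chain pi Q.
Hypothesis hB : forall w : {ffun 'I_d -> S}, 0 < nbhd_prob pi Q w.
Local Notation noise := (noise d S).
Local Notation coordinate := (coordinate d).
Local Notation layer := (layer d S).
Context (th : noise -> R) (s0 : S).
Hypothesis th_answer : forall r s,
  \sum_phi th phi * (answer phi r == s)%:R = request_law pi Q r s.
Implicit Types (c : coordinate -> noise) (x : vertex d -> S) (u v : vertex d) (L : layer).

Local Notation isum := (isum th).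
Local Notation B x v := (cond_law pi Q (nbr x v)).

(* [good_law] is the one-step Markov property: what precedes time [m] in the
   dynamics, namely [state L c m.+1], is fixed by the coordinates outside the
   chain. *)
Record good_layer L J : Prop := GoodLayer {
  good_state : forall c c' m, (forall i, future m i -> c i = c' i) ->
    state L c m = state L c' m;
  good_innov : forall c c' m v,
    (forall i, future m.+1 i || (i \in chain m v J) -> c i = c' i) ->
    innov L c m v = innov L c' m v;
  good_local_state : forall m v, local (fun c => state L c m v);
  good_local_innov : forall m v, local (fun c => innov L c m v);
  good_law : forall c m v (G : S -> R),
    isum (chain m v J) (fun c => G (innov L c m v)) c
    = \sum_s B (state L c m.+1) v s * G s }.

Lemma base_layer_good : good_layer (base_layer d s0) 1.
Proof.
split=> //=.
- by move=> c c' m v cc'; rewrite cc'// chainP /= !eqxx orbT.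
- by move=> m v; exact: local_cst.
- move=> m v; apply: (local_comp (fun phi => answer phi _)); exact: local_coord.
- move=> c m v G; rewrite -(sum_answer th_answer (ask_update _)).
  by apply: eq_bigr => phi _; rewrite upd_same.
Qed.

Section Next.
Variables (L : layer) (J : nat).
Hypothesis gL : good_layer L J.
Variables (K : nat) (z0 : (coordinate -> noise) -> vertex d -> S).
Hypothesis z0_source : forall c c', (forall i, i.1.2 = 1%N -> c i = c' i) -> z0 c = z0 c'.
Hypothesis z0_local : forall v, local (fun c => z0 c v).
Local Notation L' := (next_layer L K z0 J.+2).

Lemma coupled_innov_agree c c' m v x :
  (forall i, future m.+1 i || (i \in chain m v J.+1) -> c i = c' i) ->
  coupled_innov L J.+2 c m v x = coupled_innov L J.+2 c' m v x.
Proof.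
move=> cc'; rewrite /coupled_innov (cc' ((m, J.+2), v)); last first.
  by rewrite chainS mem_cat inE eqxx !orbT.
rewrite (good_state gL (c := c) (c' := c')); last by move=> i fi; rewrite cc'// fi.
rewrite (good_innov gL (c := c) (c' := c'))// => i /orP[fi|ic]; first by rewrite cc'// fi.
by apply: cc'; rewrite chainS mem_cat ic !orbT.
Qed.

Lemma next_state c c' m : (forall i, future m i -> c i = c' i) ->
  state L' c m = state L' c' m.
Proof.
move En : (K - m)%N => n; elim: n m En => [|n IH] m En cc'.
  have Km : (K <= m)%N by rewrite -subn_eq0 En.
  rewrite !next_layer_init//; apply: z0_source => i i1.
  by apply: cc'; rewrite /future i1 eqxx orbT.
have mK : (m < K)%N by rewrite -subn_gt0 En.
have Em : (K - m.+1 = n)%N by rewrite subnS En.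
have E1 := IH m.+1 Em (fun i fi => cc' i (futureW fi)).
apply/funext => v; have St := @next_layer_steps _ _ L K z0 J.+2.
rewrite (St c _ _ mK) (St c' _ _ mK) E1.
rewrite (@active_agree _ _ c c'); last by move=> u; rewrite cc'// /future leqnn.
case: ifP => // _; rewrite /= -[run _ _ _ _ c _]/(state L' c m.+1) E1.
apply: coupled_innov_agree => i /orP[fi|ic]; apply: cc'; first exact: futureW.
exact: chain_future_up ic.
Qed.

Lemma next_innov c c' m v :
  (forall i, future m.+1 i || (i \in chain m v J.+1) -> c i = c' i) ->
  innov L' c m v = innov L' c' m v.
Proof.
move=> cc'; rewrite /= -[run _ _ _ _ c _]/(state L' c m.+1).
rewrite (next_state (c' := c')); last by move=> i fi; rewrite cc'// fi.
exact: coupled_innov_agree.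
Qed.

Lemma local_coupled_innov m v (x : (coordinate -> noise) -> vertex d -> S) :
  (forall u, local (fun c => x c u)) ->
  local (fun c => coupled_innov L J.+2 c m v (x c)).
Proof.
move=> lx; apply: (local_comp2 (@answer d S)); first exact: local_coord.
apply: (local_comp3 (@ask_coupled d S)); try exact: local_nbr.
- by apply: local_nbr => u; exact: good_local_state gL _ _.
- exact: good_local_innov gL _ _.
Qed.

Lemma local_next_state m v : local (fun c => state L' c m v).
Proof.
rewrite /=; move: (K - m)%N => n; elim: n v => [|n IH] v //=.
apply: (local_comp3 (fun (b : bool) (a a' : S) => if b then a else a')) => //.
  exact: local_active.
exact: local_coupled_innov.
Qed.

Lemma local_next_innov m v : local (fun c => innov L' c m v).
Proof. by apply: local_coupled_innov => u; exact: (local_next_state m.+1). Qed.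

(** The last coordinate of the chain, in layer [J.+2], affects neither the past nor the innovation
    of [L]; averaging over it first yields a draw from the coupling. The rest of the chain is then
    handled by [good_law] for [L]. *)
Lemma coupled_law c m v (G : S -> S -> R) :
  isum (chain m v J.+1) (fun c => G (innov L c m v) (innov L' c m v)) c
  = \sum_a B (state L c m.+1) v a
    * \sum_b coupling (B (state L c m.+1) v) (B (state L' c m.+1) v) a b * G a b.
Proof.
pose H c a := \sum_b coupling (B (state L c m.+1) v) (B (state L' c m.+1) v) a b * G a b.
rewrite chainS isum_cat.
transitivity (isum (chain m v J) (fun c1 => H c (innov L c1 m v)) c).
  apply: eq_isum => c1 cc1.
  have S1 i : future m.+1 i -> c1 i = c i.
    by move=> fi; apply: cc1; apply: contraTN fi => /chain_future ->.
  rewrite /H -(good_state gL S1) -(next_state S1).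
  rewrite -(sum_answer th_answer (ask_coupled _ _ _)) /=; apply: eq_bigr => phi _.
  pose c2 := upd c1 ((m, J.+2), v) phi; rewrite -/c2.
  have S2 i : future m.+1 i || (i \in chain m v J) -> c2 i = c1 i.
    rewrite /c2 /upd; case: eqP => // ->.
    by rewrite chainP /future /= ltnn !eqxx ltnn.
  have F2 i : future m.+1 i -> c2 i = c1 i by move=> fi; rewrite S2// fi.
  rewrite (good_innov gL S2) /coupled_innov (good_innov gL S2) (good_state gL F2).
  rewrite -[run _ _ _ _ c2 _]/(state L' c2 m.+1) (next_state F2).
  by rewrite /c2 upd_same.
exact: (good_law gL).
Qed.

Lemma next_layer_good : good_layer L' J.+1.
Proof.
split.
- exact: next_state.
- exact: next_innov.
- exact: local_next_state.
- exact: local_next_innov.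
- move=> c m v G; rewrite (coupled_law c m v (fun _ b => G b)).
  under eq_bigr => a _ do rewrite mulr_sumr.
  rewrite exchange_big /=; apply: eq_bigr => b _.
  under eq_bigr => a _ do rewrite mulrA.
  by rewrite -mulr_suml coupling_marginal//; exact: cond_law_is_law.
Qed.

End Next.

Lemma nth_layer_good k : good_layer (nth_layer d s0 k) k.+1.
Proof.
elim: k => [|k IH]; first exact: base_layer_good.
by apply: next_layer_good => // v; exact: local_cst.
Qed.

End GoodLayers.

(** * Contraction and stationarity *)

Section Convergence.
Context (R : realType) (d : nat) (S : finType) (pi : S -> R) (Q : S -> S -> R).
Hypothesis hQ : reversible_chain pi Q.
Hypothesis hB : forall w : {ffun 'I_d -> S}, 0 < nbhd_prob pi Q w.
Local Notation noise := (noise d S).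
Local Notation coordinate := (coordinate d).
Local Notation layer := (layer d S).
Context (th : noise -> R) (a0 : noise) (s0 : S).
Hypothesis th_ge0 : forall phi, 0 <= th phi.
Hypothesis th_sum1 : \sum_phi th phi = 1.
Hypothesis th_answer : forall r s,
  \sum_phi th phi * (answer phi r == s)%:R = request_law pi Q r s.
Hypothesis th_coin : \sum_phi th phi * phi.1%:R = 2^-1.
Implicit Types (c : coordinate -> noise) (x : vertex d -> S) (u v : vertex d) (L : layer).

Local Notation E := (expect th a0).
Local Notation isum := (isum th).
Local Notation B x v := (cond_law pi Q (nbr x v)).
Local Notation good_layer := (good_layer pi Q th).
Local Notation D := (dobrushin d pi Q).

(** The bit of the vertex must be set and those of its [d] neighbours must not. *)
Definition active_prob : R := 2^-1 ^+ d.+1.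

Definition rate : R := 1 - active_prob * (1 - d%:R * D).

Definition bits m v : seq coordinate :=
  ((m, 0)%N, v) :: [seq ((m, 0)%N, step i v) | i : 'I_d].

(** The factor [h] prescribes the bit at each coordinate: set at [v], unset elsewhere. A vertex and
    its [d] neighbours are distinct, so the sum splits into [d.+1] factors 1/2. *)
Lemma isum_active m v c :
  isum (bits m v) (fun c => (active c m v)%:R) c = active_prob.
Proof.
pose h (i : coordinate) (phi : noise) : R := (phi.1 == (i.2 == v))%:R.
have -> : (fun c => (active c m v)%:R)
    = (fun c => \prod_(i <- bits m v) h i (c i)) :> (_ -> R).
  apply/funext => c1; rewrite /bits big_cons big_map /h /= eqxx eqb_id.
  rewrite /active -/(bit c1 m v); case: (bit c1 m v); last by rewrite mul0r.
  rewrite mul1r; case: forallP => /= hi.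
    rewrite big1// => i _; rewrite (negbTE (step_neq _ _)).
    by move: (hi i); rewrite /bit => /negbTE ->.
  have [i /negP] : exists i, ~ ~~ bit c1 m (step i v).
    by apply/existsNP => h1; apply: hi.
  rewrite negbK => bi; rewrite (big_rem i) ?mem_enum//=.
  by rewrite (negbTE (step_neq _ _)) (_ : _.1 = true)//= mul0r.
rewrite isum_uniq_prod; last first.
  rewrite /bits /= map_inj_uniq ?enum_uniq ?andbT; last first.
    by move=> i j /(congr1 snd); exact: step_inj.
  by apply/mapP => -[i _ /(congr1 snd)/= vi]; have := step_neq i v; rewrite -vi eqxx.
have hf i : \sum_phi th phi * h i phi = 2^-1.
  rewrite /h; case: (i.2 == v).
    by rewrite -[RHS]th_coin; apply: eq_bigr => phi _; case: (phi.1).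
  transitivity (\sum_phi (th phi - th phi * phi.1%:R)).
    by apply: eq_bigr => phi _; case: (phi.1) => /=; ring.
  by rewrite sumrB th_sum1 th_coin; field.
rewrite (eq_bigr (fun=> 2^-1))// big_const_seq count_predT iter_mulr_1 /bits /=.
by rewrite size_map size_enum_ord.
Qed.

Definition disagree (x y : vertex d -> S) v : R := (x v != y v)%:R.

(** * Contraction for a pair of coupled trajectories *)

Section Pair.
Variables (L : layer) (J : nat).
Hypothesis gL : good_layer L J.
Variables (K : nat) (z0 : (coordinate -> noise) -> vertex d -> S).
Hypothesis z0_source : forall c c', (forall i, i.1.2 = 1%N -> c i = c' i) -> z0 c = z0 c'.
Hypothesis z0_local : forall v, local (fun c => z0 c v).
Variable M : nat.
Hypothesis sL : steps_until L M.
Hypothesis MK : (M <= K)%N.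
Local Notation L' := (next_layer L K z0 J.+2).

Let gL' : good_layer L' J.+1.
Proof. exact: next_layer_good. Qed.

Let dis c m v := disagree (state L c m) (state L' c m) v.

Let local_dis m v : local (fun c => dis c m v).
Proof.
apply: (local_comp2 (fun a b => (a != b)%:R : R)).
  exact: good_local_state gL _ _.
exact: good_local_state gL' _ _.
Qed.

(** The chain contains no bits, so activity is frozen. An inactive vertex keeps its disagreement; at
    an active one the innovations differ with probability at most the distance of the two
    conditional laws, bounded by [dTV_dobrushin]. *)
Lemma disagree_step m v c : (m < M)%N ->
  isum (chain m v J.+1) (fun c => dis c m v) c
  <= (active c m v)%:R * (D * \sum_i dis c m.+1 (step i v) - dis c m.+1 v)
     + dis c m.+1 v.
Proof.
move=> mM; have mK := leq_trans mM MK.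
pose I c1 : R := (innov L c1 m v != innov L' c1 m v)%:R.
have -> : isum (chain m v J.+1) (fun c => dis c m v) c = isum (chain m v J.+1)
    (fun c1 => (active c m v)%:R * (I c1 - dis c m.+1 v) + dis c m.+1 v) c.
  apply: eq_isum => c1 cc1.
  have S1 i : future m.+1 i -> c1 i = c i.
    by move=> fi; apply: cc1; apply: contraTN fi => /chain_future ->.
  rewrite /dis /disagree (sL c1 v mM) (next_layer_steps L z0 J.+2 c1 v mK).
  rewrite (@active_agree _ _ c1 c); last first.
    by move=> u; apply: cc1; rewrite chainP /= andbF.
  rewrite (good_state gL S1) (good_state gL' S1).
  by case: ifP => _ /=; rewrite ?mul1r ?subrK ?mul0r ?add0r.
rewrite isumD isumZl !(isum_cst th_sum1) lerD2r; apply: ler_wpM2l; first exact: ler0n.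
rewrite (isumD _ _ I) (isum_cst th_sum1) lerD2r.
rewrite /I (coupled_law th_answer gL K z0_source c m v (fun a b => (a != b)%:R)).
apply: le_trans (coupling_neq _ _) _; try exact: cond_law_is_law.
apply: le_trans (dTV_dobrushin _ _ _ _) _.
by apply: ler_wpM2l; [exact: dobrushin_ge0|apply: ler_sum => i _; rewrite !ffunE].
Qed.

(** The bits of time [m] do not influence the states at [m.+1], so activity averages to
    [active_prob] independently of the earlier disagreements. The bound is uniform in [v], which
    lets the induction hypothesis apply to the neighbours too. *)
Lemma disagree_decay n m v : (m + n = M)%N ->
  E (fun c => disagree (state L c m) (state L' c m) v) <= rate ^+ n.
Proof.
elim: n m v => [|n IH] m v mnM.
  rewrite expr0 -[leRHS](expect_cst coordinate th_sum1 a0).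
  apply: le_expect => //; [exact: local_dis|exact: local_cst|].
  by move=> c; rewrite /disagree lern1 leq_b1.
have mM : (m < M)%N by rewrite -mnM addnS ltnS leq_addr.
pose X c := D * \sum_i dis c m.+1 (step i v).
pose Y c := dis c m.+1 v.
have lX : local X.
  apply: (local_fin (g := fun i c => dis c m.+1 (step i v)) (fun f => D * \sum_i f i)) => i.
  exact: local_dis.
have lY : local Y by exact: local_dis.
have la : local (fun c => (active c m v)%:R : R).
  by apply: (local_comp (fun b : bool => b%:R)); exact: local_active.
have lXY : local (fun c => X c - Y c) by exact: (local_comp2 (fun a b => a - b)).
have laXY : local (fun c => (active c m v)%:R * (X c - Y c)).
  exact: (local_comp2 (fun a b => a * b)).
have laXYY : local (fun c => (active c m v)%:R * (X c - Y c) + Y c).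
  exact: (local_comp2 (fun a b => a + b)).
have Yfut c c' : (forall i, future m.+1 i -> c i = c' i) ->
    forall u, dis c m.+1 u = dis c' m.+1 u.
  by move=> cc' u; rewrite /dis (good_state gL cc') (good_state gL' cc').
have bfut i : i \in bits m v -> future m.+1 i = false.
  by rewrite inE => /predU1P[->|/mapP[j _ ->]]; rewrite /future /= ltnn.
have iXY : ignores (bits m v) (fun c => X c - Y c).
  move=> c c' cc'; have Y1 := Yfut c c' _; rewrite /X /Y Y1; last first.
    by move=> i fi; apply: cc'; apply: contraTN fi => /bfut ->.
  congr (D * _ - _); apply: eq_bigr => i _; apply: Y1 => k fk.
  by apply: cc'; apply: contraTN fk => /bfut ->.
have iY : ignores (bits m v) Y.
  move=> c c' cc'; apply: Yfut => i fi.
  by apply: cc'; apply: contraTN fi => /bfut ->.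
rewrite (expect_tower th_sum1 a0 (chain m v J.+1)); last exact: local_dis.
apply: (@le_trans _ _ (E (fun c => (active c m v)%:R * (X c - Y c) + Y c))).
  apply: le_expect => //; first by apply: local_isum; exact: local_dis.
  by move=> c; exact: disagree_step.
(* The innovations at time [m] have been averaged out; now average over the bits that decide whether
   [v] is active. *)
rewrite (expect_tower th_sum1 a0 (bits m v))//.
have -> : isum (bits m v) (fun c => (active c m v)%:R * (X c - Y c) + Y c)
    = (fun c => active_prob * X c + (1 - active_prob) * Y c).
  apply/funext => c; rewrite isumD [X in _ + X](isum_ignores th_sum1)//.
  rewrite (eq_isum _ (h := fun c => (X c - Y c) * (active c m v)%:R)); last first.
    by move=> c1 _; exact: mulrC.
  by rewrite isumZ// isum_active; ring.
have p0 : 0 <= active_prob by rewrite exprn_ge0// invr_ge0.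
have p1 : active_prob <= 1 by rewrite exprn_ile1// ?invr_ge0// invf_le1// ler1n.
rewrite (expectD th_sum1 a0 (local_comp (fun a => active_prob * a) lX)
  (local_comp (fun a => (1 - active_prob) * a) lY)).
rewrite (expectZ th_sum1 a0 _ lX) (expectZ th_sum1 a0 _ lY).
have IHd u : E (fun c => dis c m.+1 u) <= rate ^+ n by apply: IH; rewrite addSnnS.
have EX : E X <= D * (d%:R * rate ^+ n).
  rewrite expectZ//; last first.
    by apply: (local_fin (g := fun i c => dis c m.+1 (step i v)) (fun f => \sum_i f i)) => i.
  apply: ler_wpM2l; first exact: dobrushin_ge0.
  rewrite expect_sum//.
  apply: (@le_trans _ _ (\sum_(i < d) rate ^+ n)).
    by apply: ler_sum => i _; exact: IHd.
  by rewrite sumr_const cardT size_enum_ord mulr_natl.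
have -> : rate ^+ n.+1
  = active_prob * (D * (d%:R * rate ^+ n)) + (1 - active_prob) * rate ^+ n.
  by rewrite exprS {1}/rate; ring.
apply: lerD; first exact: ler_wpM2l p0 _ _ EX.
by apply: ler_wpM2l; [rewrite subr_ge0|exact: IHd].
Qed.

End Pair.

(* The bits are kept as arguments of the test functions because they decide
   which vertices are resampled. *)
Definition bit_local (G : (coordinate -> noise) -> (vertex d -> S) -> R) :=
  exists s : seq coordinate, exists F : seq (vertex d),
    {in s, forall i, i.1.2 = 0%N} /\
    forall c c' x x', {in s, c =1 c'} -> {in F, x =1 x'} -> G c x = G c' x'.

Lemma local_bit_local G (x : (coordinate -> noise) -> vertex d -> S) :
  bit_local G -> (forall v, local (fun c => x c v)) -> local (fun c => G c (x c)).
Proof.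
move=> [s [F [s0' dG]]] lx; have [t dt] := local_seq F lx.
exists (s ++ t) => c c' cc'; apply: dG => [i si|v vF].
  by apply: cc'; rewrite mem_cat si.
by apply: dt => // i ti; apply: cc'; rewrite mem_cat ti orbT.
Qed.

Definition resample_active m u (G : (coordinate -> noise) -> (vertex d -> S) -> R) c x : R :=
  if active c m u then resample pi Q u (G c) x else G c x.

Lemma bit_local_resample m u G : bit_local G -> bit_local (resample_active m u G).
Proof.
move=> [s [F [s0' dG]]].
exists (s ++ bits m u), (F ++ [seq step i u | i : 'I_d]); split.
  move=> i; rewrite mem_cat => /orP[/s0'//|].
  by rewrite inE => /predU1P[->//|/mapP[j _ ->]].
move=> c c' x x' cc' xx'; rewrite /resample_active.
have -> : active c m u = active c' m u.
  rewrite /active /bit cc'; last by rewrite mem_cat inE eqxx orbT.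
  congr (_ && _); apply: eq_forallb => i; rewrite cc'// mem_cat inE.
  by apply/orP; right; apply/orP; right; apply: map_f; rewrite mem_enum.
have GG y y' : {in F, y =1 y'} -> G c y = G c' y'.
  by apply: dG => i si; apply: cc'; rewrite mem_cat si.
have xxF : {in F, x =1 x'} by move=> v vF; apply: xx'; rewrite mem_cat vF.
case: ifP => _; last exact: GG.
rewrite /resample; have -> : nbr x u = nbr x' u.
  apply/ffunP => i; rewrite !ffunE; apply: xx'; rewrite mem_cat.
  by apply/orP; right; apply: map_f; rewrite mem_enum.
apply: eq_bigr => a _; congr (_ * _); apply: GG => v vF.
by rewrite /upd; case: ifP => // _; exact: xxF.
Qed.

(** Bits live in layer 0 and the branching sample reads layer 1 only. Conditionally on everything
    outside [Y], activity and test function are fixed, and the claim becomes [branch_resample]. *)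
Lemma branch_resample_active m u G : bit_local G ->
  E (fun c => resample_active m u G c (branch c)) = E (fun c => G c (branch c)).
Proof.
move=> bG; have [s [F [s0' dG]]] := bG.
have [Y Y1 dY] := branch_depends S (F ++ [seq step i u | i : 'I_d]).
have lb := @local_branch d S.
rewrite (expect_tower th_sum1 a0 Y); last first.
  by apply: local_bit_local => //; exact: bit_local_resample.
rewrite [RHS](expect_tower th_sum1 a0 Y); last exact: local_bit_local.
congr expect; apply/funext => c.
have dGc : depends F (G c) by move=> x x'; exact: dG.
have YF0 c1 : (forall i, i \notin Y -> c1 i = c i) -> forall i, i.1.2 = 0%N -> c1 i = c i.
  by move=> cc i i0; apply: cc; apply/negP => /Y1[w iw]; rewrite iw in i0.
have -> : isum Y (fun c => G c (branch c)) c = isum Y (fun c1 => G c (branch c1)) c.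
  apply: eq_isum => c1 /YF0 cc; apply: dG => // i /s0' i0; exact: cc.
have -> : isum Y (fun c => resample_active m u G c (branch c)) c
    = isum Y (fun c1 => resample_active m u (fun=> G c) c (branch c1)) c.
  apply: eq_isum => c1 /YF0 cc; rewrite /resample_active.
  rewrite (@active_agree _ _ c1 c); last by move=> w; exact: cc.
  have Gc1 : G c1 = G c by apply/funext => x; apply: dG => // i /s0' i0; exact: cc.
  by rewrite Gc1.
rewrite /resample_active; case: (active c m u) => //.
have d1 : depends Y (fun c1 => resample pi Q u (G c) (branch c1)).
  by move=> c1 c2 /dY h; apply: (depends_resample pi Q (u := u) dGc).
have d2 : depends Y (fun c1 => G c (branch c1)).
  by move=> c1 c2 /dY h; apply: dGc => v vF; apply: h; rewrite mem_cat vF.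
rewrite -(expectE th_sum1 a0 c d1) -(expectE th_sum1 a0 c d2).
by apply: (branch_resample hQ hB a0 th_sum1 th_answer); exists F.
Qed.

(** * Invariance of the branching Markov law under the parallel dynamics *)

Section Stationary.
Variables (L : layer) (J : nat).
Hypothesis gL : good_layer L J.

(** Interpolates between the states at times [m.+1] and [m], so that a parallel update can be
    carried out one vertex at a time. *)
Definition partial_update m (l : seq (vertex d)) c v : S :=
  if (v \in l) && active c m v then innov L c m v else state L c m.+1 v.

Lemma local_partial_update m l v : local (fun c => partial_update m l c v).
Proof.
apply: (local_comp3 (fun (b : bool) (a a' : S) => if (v \in l) && b then a else a')).
- exact: local_active.
- exact: good_local_innov gL _ _.
- exact: good_local_state gL _ _.
Qed.

Lemma partial_update_cons m l u G c : u \notin l -> bit_local G ->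
  isum (chain m u J) (fun c => G c (partial_update m (u :: l) c)) c
  = resample_active m u G c (partial_update m l c).
Proof.
move=> ul [s [F [s0' dG]]].
pose x := partial_update m l c.
pose H c1 := if active c m u then G c (upd x u (innov L c1 m u)) else G c x.
transitivity (isum (chain m u J) H c).
  apply: eq_isum => c1 cc1.
  have S1 i : future m.+1 i -> c1 i = c i.
    by move=> fi; apply: cc1; apply: contraTN fi => /chain_future ->.
  have A1 w : active c1 m w = active c m w.
    by apply: active_agree => z; apply: cc1; rewrite chainP /= andbF.
  have x1 w : w != u -> partial_update m (u :: l) c1 w = x w.
    move=> wu; rewrite /x /partial_update inE (negbTE wu)/= A1 (good_state gL S1).
    case: ifP => // _; apply: (good_innov gL) => i /orP[/S1//|iw]; apply: cc1.
    apply: contraTN iw; rewrite !chainP => /and3P[_ _ /eqP ->].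
    by rewrite [u == w]eq_sym (negbTE wu) !andbF.
  have Gc1 y : G c1 y = G c y.
    apply: dG => // i /s0' i0; apply: cc1; rewrite chainP i0 /=.
    by rewrite andbF.
  rewrite Gc1 /H; case: ifP => au; congr (G c _); apply/funext => w.
    rewrite /upd; have [->|wu] := eqVneq w u; last exact: x1.
    by rewrite /partial_update inE eqxx A1 au.
  have [->|wu] := eqVneq w u; last exact: x1.
  by rewrite /x /partial_update A1 au !andbF (good_state gL S1).
rewrite /H /resample_active; case: ifP => au; last by rewrite (isum_ignores th_sum1).
rewrite (good_law gL c m u (fun a => G c (upd x u a))) /resample.
(* An active [u] has no active neighbour, so the updates made so far left its neighbourhood as at
   time [m.+1], which is what its innovation is conditioned on. *)
suff -> : nbr x u = nbr (state L c m.+1) u by [].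
by apply/ffunP => i; rewrite !ffunE /x /partial_update active_step ?andbF.
Qed.

(** Averaging over the chain of one more vertex turns its update into an operator acting on the test
    function. The new test function depends on the bits, stays [bit_local], and loses the operator
    again by [branch_resample_active]. *)
Lemma partial_update_law m G l :
  (forall G, bit_local G ->
     E (fun c => G c (state L c m.+1)) = E (fun c => G c (branch c))) ->
  bit_local G ->
  E (fun c => G c (partial_update m l c)) = E (fun c => G c (branch c)).
Proof.
move=> IHm; elim: l G => [|u l IHl] G bG.
  by rewrite -IHm.
have [ul|ul] := boolP (u \in l).
  rewrite -IHl//; congr expect; apply/funext => c; congr (G c _).
  apply/funext => v; rewrite /partial_update inE.
  by case: eqVneq => [->|]//=; rewrite ul.
rewrite (expect_tower th_sum1 a0 (chain m u J)); last first.
  by apply: local_bit_local => // v; exact: local_partial_update.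
rewrite -(branch_resample_active m u bG) -IHl; last exact: bit_local_resample.
by congr expect; apply/funext => c; exact: partial_update_cons.
Qed.

Variable K : nat.
Hypothesis sL : steps_until L K.
Hypothesis LK : forall c, state L c K = branch c.

Lemma stationary_layer n m G : (m + n = K)%N -> bit_local G ->
  E (fun c => G c (state L c m)) = E (fun c => G c (branch c)).
Proof.
elim: n m G => [|n IH] m G mn bG.
  rewrite addn0 in mn; rewrite mn; congr expect; apply/funext => c.
  by rewrite LK.
have mK : (m < K)%N by rewrite -mn addnS ltnS leq_addr.
have [s [F [s0' dG]]] := bG.
(* The test function sees only the finite list [F], so it is enough to update the vertices of
   [F]. *)
rewrite -(@partial_update_law m G F)//; last by move=> G' ?; apply: IH; rewrite // addSnnS.
congr expect; apply/funext => c; apply: dG => // v vF.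
by rewrite /partial_update vF /= sL.
Qed.

End Stationary.

Local Notation layer_at k := (nth_layer d s0 k).

(** It reads the same noise layer [k.+3] as the trajectory [k.+1]; each of the two is compared with
    trajectory [k] only, never with the other. *)
Definition stationary_partner k : layer :=
  next_layer (layer_at k) k (@branch d S) k.+3.

Lemma local_indicator (F : seq (vertex d)) x (y : (coordinate -> noise) -> vertex d -> S) :
  (forall v, local (fun c => y c v)) ->
  local (fun c => (all (fun v => y c v == x v) F)%:R : R).
Proof.
move=> ly; apply: (local_seqP (r := F) (g := fun v c => y c v)
  (h := fun f => (all (fun v => f v == x v) F)%:R)) => // f f' ff'.
by congr (nat_of_bool _)%:R; apply: eq_in_all => v vF; rewrite ff'.
Qed.

(** The partner has exactly the branching cylinder probabilities by [stationary_layer]. The two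
    indicators can differ only if some vertex of [F] disagrees: a union bound over [F] and
    [disagree_decay] conclude. *)
Lemma nth_layer_cylinder k (F : {fset vertex d}) x : tree_closed F ->
  `|E (fun c => (all (fun v => state (layer_at k) c 0 v == x v) F)%:R)
    - cylinder_weight pi Q F x| <= #|` F|%:R * rate ^+ k.
Proof.
move=> cF; pose Z := stationary_partner k.
have gk : good_layer (layer_at k) k.+1 by exact: nth_layer_good.
have bs := @branch_depends_source d S.
have lb := @local_branch d S.
have gZ : good_layer Z k.+2 by exact: next_layer_good.
have <- : E (fun c => (all (fun v => state Z c 0 v == x v) F)%:R) = cylinder_weight pi Q F x.
  rewrite -(branch_cylinder_expect a0 th_sum1 th_answer)//.
  pose G (_ : coordinate -> noise) (y : vertex d -> S) : R := (all (fun v => y v == x v) F)%:R.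
  apply: (@stationary_layer Z k.+2 gZ k _ _ k 0%N G) => //.
  - exact: next_layer_steps.
  - by move=> c; rewrite next_layer_init.
  - exists [::], F; split=> // c c' y y' _ yy'.
    by congr (nat_of_bool _)%:R; apply: eq_in_all => v vF; rewrite yy'.
have ls v : local (fun c => state (layer_at k) c 0 v) by exact: good_local_state gk _ _.
have lZ v : local (fun c => state Z c 0 v) by exact: good_local_state gZ _ _.
have ldis v : local (fun c => disagree (state (layer_at k) c 0) (state Z c 0) v).
  exact: (local_comp2 (fun a b => (a != b)%:R : R)).
have lsum : local (fun c => \sum_(v <- F) disagree (state (layer_at k) c 0) (state Z c 0) v).
  apply: (local_seqP (r := F) 
    (g := fun v c => disagree (state (layer_at k) c 0) (state Z c 0) v)
    (h := fun f => \sum_(v <- F) f v)) => // f f' ff'; exact: eq_big_seq.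
have Esum : E (fun c => \sum_(v <- F) disagree (state (layer_at k) c 0) (state Z c 0) v)
    <= #|` F|%:R * rate ^+ k.
  rewrite expect_sum//; apply: (@le_trans _ _ (\sum_(v <- F) rate ^+ k)).
    apply: ler_sum => v _.
    exact: (disagree_decay gk bs lb (@nth_layer_steps d S s0 k) (leqnn k) v (add0n k)).
  by rewrite big_const_seq count_predT iter_addr_0 mulr_natl.
have le1 (y z : vertex d -> S) : (all (fun v => y v == x v) F)%:R
    <= (all (fun v => z v == x v) F)%:R + \sum_(v <- F) disagree y z v :> R.
  have s_ge0 (r : seq (vertex d)) : 0 <= \sum_(v <- r) disagree y z v.
    by apply: sumr_ge0 => v _; exact: ler0n.
  have [/allP hy|_] := boolP (all (fun v => y v == x v) F); last by rewrite addr_ge0.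
  have [_|/allPn[v vF vz]] := boolP (all (fun v => z v == x v) F); first by rewrite lerDl.
  rewrite add0r (big_rem v)//= /disagree (eqP (hy v vF)) eq_sym vz lerDl.
  exact: s_ge0.
have lI y : (forall v, local (fun c => y c v)) ->
  local (fun c => (all (fun v => y c v == x v) F)%:R : R) by exact: local_indicator.
rewrite ler_distl; apply/andP; split.
  rewrite lerBlDr; apply: le_trans (lerD (lexx _) Esum); rewrite -expectD//; last exact: lI.
  apply: le_expect => //; first exact: lI.
    by apply: (local_comp2 (fun a b => a + b)); [exact: lI|].
  move=> c; apply: le_trans (le1 _ (state (layer_at k) c 0)) _.
  rewrite lerD2l; apply: ler_sum => v _.
  by rewrite /disagree eq_sym.
apply: le_trans (lerD (lexx _) Esum); rewrite -expectD//; last exact: lI.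
apply: le_expect => //; first exact: lI.
by apply: (local_comp2 (fun a b => a + b)); [exact: lI|].
Qed.

Lemma nth_layer_disagree k v :
  E (fun c => disagree (state (layer_at k) c 0) (state (layer_at k.+1) c 0) v) <= rate ^+ k.
Proof.
have gk : good_layer (layer_at k) k.+1 by exact: nth_layer_good.
apply: (@disagree_decay _ _ gk k.+1 (fun _ _ => s0) _ _ k (@nth_layer_steps d S s0 k)) => //.
by move=> w; exact: local_cst.
Qed.

End Convergence.

(** * Splitting the digits of a uniform variable *)

Section ImageMeasure.
Local Open Scope ereal_scope.
Context d d' (T1 : measurableType d) (T2 : measurableType d') (R : realType).
Context (m : {measure set T1 -> \bar R}) (f : T1 -> T2).
Hypothesis mf : measurable_fun setT f.

Definition image_measure (_ : measurable_fun setT f) (A : set T2) : \bar R := m (f @^-1` A).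

Let image0 : image_measure mf set0 = 0.
Proof. by rewrite /image_measure preimage_set0 measure0. Qed.

Let image_ge0 A : 0 <= image_measure mf A.
Proof. exact: measure_ge0. Qed.

Let image_sigma_additive : semi_sigma_additive (image_measure mf).
Proof. exact: (@measure_semi_sigma_additive _ _ _ (pushforward m f)). Qed.

HB.instance Definition _ := isMeasure.Build _ _ _
  (image_measure mf) image0 image_ge0 image_sigma_additive.

End ImageMeasure.

Section UniformOnR.
Context {R : realType}.
Local Notation Rm := (measurableTypeR R).
Local Notation lambda := (@lebesgue_measure R).

Lemma measurable_unit_itv : measurable (`[0, 1[%classic : set Rm).
Proof. exact: measurable_itv. Qed.

Definition unif : {measure set Rm -> \bar R} :=
  mrestr lambda measurable_unit_itv.

(** The distribution function of the uniform law and, at the same time, the retraction of the line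
    onto [0,1]. *)
Definition clamp (x : R) : R := Num.max 0 (Num.min 1 x).

Lemma clampE x : [\/ x <= 0 /\ clamp x = 0, [/\ 0 <= x, x <= 1 & clamp x = x]
                  | 1 <= x /\ clamp x = 1].
Proof.
rewrite /clamp; have [x0|x0] := leP x 0.
  by constructor 1; split=> //; apply/max_idPl; rewrite ge_min x0 orbT.
have [x1|x1] := leP x 1.
  by constructor 2; split; rewrite ?(min_idPr x1) ?(max_idPr _)// ltW.
by constructor 3; split; rewrite ?(min_idPl (ltW x1)) ?(max_idPr _)// ltW.
Qed.

Lemma clamp_le0 x : x <= 0 -> clamp x = 0.
Proof. by case: (clampE x) => -[] * //; lra. Qed.

Lemma clamp_ge1 x : 1 <= x -> clamp x = 1.
Proof. by case: (clampE x) => -[] * //; lra. Qed.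

Lemma clamp_ge0 x : 0 <= clamp x.
Proof. by case: (clampE x) => -[] * //; lra. Qed.

Lemma clamp_le1 x : clamp x <= 1.
Proof. by case: (clampE x) => -[] * //; lra. Qed.

Lemma clamp_halve x : clamp x = 2^-1 * (clamp (2 * x) + clamp (2 * x - 1)).
Proof.
case: (clampE x) => -[] *; case: (clampE (2 * x)) => -[] *;
  case: (clampE (2 * x - 1)) => -[] *; lra.
Qed.

Lemma unifE A : unif A = lambda (A `&` `[0, 1[%classic).
Proof. by []. Qed.

Lemma unif_ray x : unif `]-oo, x[%classic = (clamp x)%:E.
Proof.
rewrite unifE.
have -> : `]-oo, x[%classic `&` `[0, 1[%classic = `[0, (clamp x)[%classic :> set R.
  apply/seteqP; split=> y /=; rewrite !in_itv /=.
    by move=> [yx /andP[y0 y1]]; rewrite y0; case: (clampE x) => -[] *; lra.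
  move=> /andP[y0 yx]; rewrite y0.
  by case: (clampE x) => -[] *; split; lra.
rewrite lebesgue_measure_itv /= lte_fin; case: ltP => [_|h].
  by rewrite sube0.
by congr EFin; apply/eqP; rewrite eq_le h clamp_ge0.
Qed.

Lemma unifT : unif setT = 1%E.
Proof.
by rewrite unifE setTI lebesgue_measure_itv /= lte_fin ltr01 sube0.
Qed.

Lemma unif_le1 A : measurable A -> (unif A <= 1)%E.
Proof. by move=> mA; rewrite -unifT le_measure ?inE. Qed.

Lemma unif_fin A : measurable A -> unif A \is a fin_num.
Proof.
move=> mA; rewrite ge0_fin_numE ?measure_ge0//.
by rewrite (le_lt_trans (unif_le1 mA))// ltry.
Qed.

Lemma unif_fine A : measurable A -> unif A = (fine (unif A))%:E.
Proof. by move=> mA; rewrite fineK// unif_fin. Qed.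

Lemma real_measure_unique (m1 m2 : {measure set Rm -> \bar R}) :
  (forall x : R, m1 `]-oo, x[%classic = m2 `]-oo, x[%classic) ->
  (forall x : R, m1 `]-oo, x[%classic < +oo)%E ->
  forall A, measurable A -> m1 A = m2 A.
Proof.
move=> m12 moo; pose g (k : nat) : set R := `]-oo, k%:R[%classic.
refine (@measure_unique _ R Rm (@RGenInftyO.G R) g _ _ _ _ m1 m2 _ _).
- exact: RGenInftyO.measurableE.
- move=> _ _ [x ->] [y ->]; exists (Num.min x y).
  by apply/seteqP; split=> z /=; rewrite !in_itv /= lt_min => /andP.
- by move=> k; exists k%:R.
- apply/seteqP; split=> // x _; exists (Num.truncn x).+1 => //.
  by rewrite /g /= in_itv /= truncnS_gt.
- by move=> _ [x ->].
- by move=> k; apply: moo.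
Qed.

(** A uniform number is half the sum of a fair digit and another uniform number. For rays this is
    [clamp_halve], and rays determine a finite measure. *)
Lemma unif_halve (A : set Rm) : measurable A ->
  unif A = (2^-1%:E * (unif [set w | A (w / 2)%R] + unif [set w | A ((w + 1) / 2)%R]))%E.
Proof.
have mh0 : measurable_fun setT (fun w : Rm => w / 2 : Rm).
  by apply: measurable_funM => //; exact: measurable_id.
have mh1 : measurable_fun setT (fun w : Rm => (w + 1) / 2 : Rm).
  by apply: measurable_funM => //; apply: measurable_funD => //; exact: measurable_id.
have h : (0 : R) <= 2^-1 by rewrite invr_ge0.
pose r : {nonneg R} := NngNum h.
pose m2 := mscale r (measure_add (image_measure unif mh0) (image_measure unif mh1)).
move=> mA.
have m2E B : m2 B
    = (2^-1%:E * (unif [set w | B (w / 2)%R] + unif [set w | B ((w + 1) / 2)%R]))%E.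
  by congr (_ * _)%E; exact: measure_addE.
transitivity (m2 A); last exact: m2E.
have E x : m2 `]-oo, x[%classic = (clamp x)%:E.
  rewrite m2E.
  have -> : [set w | `]-oo, x[%classic (w / 2)] = `]-oo, 2 * x[%classic.
    by apply/seteqP; split=> w /=; rewrite !in_itv /=; lra.
  have -> : [set w | `]-oo, x[%classic ((w + 1) / 2)] = `]-oo, 2 * x - 1[%classic.
    by apply/seteqP; split=> w /=; rewrite !in_itv /=; lra.
  by rewrite !unif_ray -EFinD -EFinM -clamp_halve.
apply: real_measure_unique A mA => x; first exact: etrans (unif_ray x) (esym (E x)).
by apply: le_lt_trans (ltry (clamp x)); rewrite le_eqVlt (unif_ray x) eqxx.
Qed.


Lemma eq_unif (A B : set R) : (forall w, 0 <= w < 1 -> A w <-> B w) ->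
  unif A = unif B.
Proof.
move=> AB; rewrite !unifE; congr (lambda _); apply/seteqP.
by split=> w /= [Aw]; rewrite in_itv /= => w01; split=> //; apply/(AB w).
Qed.

Lemma eq0_le_geometric (z : R) : (forall n, `|z| <= 2^-1 ^+ n) -> z = 0.
Proof.
move=> h; apply/eqP/negPn/negP => z0; have z1 : 0 < `|z| by rewrite normr_gt0.
have := truncnS_gt (`|z|^-1); set n := _.+1 => ngt.
have := h n; rewrite exprVn -[X in _ <= X]mul1r ler_pdivlMr ?exprn_gt0//.
have : `|z|^-1 < 2 ^+ n.
  by apply: lt_trans ngt _; rewrite -natrX ltr_nat ltn_expl.
by rewrite -(ltr_pM2l z1) divff ?gt_eqF// ltNge => /negbTE ->.
Qed.

Definition dig (u : R) : R := (2^-1 <= u)%R%:R.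
Definition dbl (u : R) : R := 2 * u - dig u.

Lemma dig_ge0 u : 0 <= dig u. Proof. exact: ler0n. Qed.
Lemma dig_le1 u : dig u <= 1. Proof. by rewrite lern1 leq_b1. Qed.

Lemma measurable_dig : measurable_fun setT (dig : Rm -> Rm).
Proof.
have -> : dig = \1_`[2^-1, +oo[%classic.
  by apply/funext => u; rewrite /dig indicE mem_setE in_itv /= andbT.
by apply: measurable_indic; exact: measurable_itv.
Qed.

Lemma measurable_dbl : measurable_fun setT (dbl : Rm -> Rm).
Proof.
apply: measurable_funB; last exact: measurable_dig.
by apply: measurable_funM => //; exact: measurable_id.
Qed.

Lemma dig_half0 w : 0 <= w < 1 -> dig (w / 2) = 0.
Proof. by rewrite /dig => h; case: leP => //; lra. Qed.

Lemma dig_half1 w : 0 <= w < 1 -> dig ((w + 1) / 2) = 1.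
Proof. by rewrite /dig => h; case: leP => //; lra. Qed.

Lemma dbl_half0 w : 0 <= w < 1 -> dbl (w / 2) = w.
Proof. by move=> h; rewrite /dbl dig_half0//; lra. Qed.

Lemma dbl_half1 w : 0 <= w < 1 -> dbl ((w + 1) / 2) = w.
Proof. by move=> h; rewrite /dbl dig_half1//; lra. Qed.

(* The number whose binary digits are the first [n] even-indexed digits of [u]. *)
Fixpoint even_prefix n (u : R) : R :=
  if n is n'.+1 then 2^-1 * (dig u + even_prefix n' (dbl (dbl u))) else 0.

Lemma even_prefix_ge0 n u : 0 <= even_prefix n u.
Proof.
elim: n u => //= n IH u.
by rewrite mulr_ge0 ?invr_ge0// addr_ge0// dig_ge0.
Qed.

Lemma even_prefix_le1 n u : even_prefix n u <= 1.
Proof.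
elim: n u => //= n IH u.
by have := IH (dbl (dbl u)); have := dig_le1 u; lra.
Qed.

Lemma even_prefixS n u : even_prefix n u <= even_prefix n.+1 u.
Proof.
elim: n u => [|n IH] u; first exact: even_prefix_ge0.
by have /= := IH (dbl (dbl u)); lra.
Qed.

Lemma measurable_even_prefix n : measurable_fun setT (even_prefix n : Rm -> Rm).
Proof.
elim: n => [|n IH]; first exact: measurable_cst.
apply: measurable_funM => //; apply: measurable_funD; first exact: measurable_dig.
exact: (measurableT_comp IH (measurableT_comp measurable_dbl measurable_dbl)).
Qed.

Definition evens u : R := limn (even_prefix ^~ u).
Definition odds u : R := evens (dbl u).

Lemma cvg_evens u : even_prefix ^~ u @ \oo --> evens u.
Proof.
apply: nondecreasing_is_cvgn.
  by apply/nondecreasing_seqP => n; exact: even_prefixS.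
by exists 1 => _ [n _ <-]; exact: even_prefix_le1.
Qed.

Lemma evens_ge0 u : 0 <= evens u.
Proof.
by apply: limr_ge; [exact: cvg_evens|apply: nearW] => n; exact: even_prefix_ge0.
Qed.

Lemma evens_le1 u : evens u <= 1.
Proof.
by apply: limr_le; [exact: cvg_evens|apply: nearW] => n; exact: even_prefix_le1.
Qed.

Lemma measurable_evens : measurable_fun setT (evens : Rm -> Rm).
Proof.
apply: (@measurable_fun_cvg _ _ _ setT even_prefix) => [n|u _].
  exact: measurable_even_prefix.
exact: cvg_evens.
Qed.

Lemma measurable_odds : measurable_fun setT (odds : Rm -> Rm).
Proof. exact: measurableT_comp measurable_evens measurable_dbl. Qed.

Lemma evens_rec u : evens u = 2^-1 * (dig u + odds (dbl u)).
Proof.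
rewrite [LHS]/evens; apply: cvg_lim => //; rewrite -cvg_shiftS /=.
by apply: cvgM; [exact: cvg_cst|]; apply: cvgD; [exact: cvg_cst|exact: cvg_evens].
Qed.

Definition joint x y : \bar R := unif [set u | evens u < x /\ odds u < y].

Lemma measurable_joint x y : measurable ([set u | evens u < x /\ odds u < y] : set Rm).
Proof.
have -> : [set u | evens u < x /\ odds u < y] =
    evens @^-1` `]-oo, x[%classic `&` odds @^-1` `]-oo, y[%classic.
  by apply/seteqP; split=> u /=; rewrite !in_itv.
rewrite -[X in measurable (X `&` _)]setTI -[X in measurable (_ `&` X)]setTI.
apply: measurableI.
  by apply: measurable_evens => //; exact: measurable_itv.
by apply: measurable_odds => //; exact: measurable_itv.
Qed.

(* Removing the first digit of [u] exchanges the roles of [evens] and [odds];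
   iterating this recursion halves, at each step, the distance between [joint]
   and the joint distribution function of two independent uniform variables. *)
Lemma joint_rec x y :
  joint x y = (2^-1%:E * (joint y (2 * x)%R + joint y (2 * x - 1)%R))%E.
Proof.
rewrite /joint unif_halve; last exact: measurable_joint.
congr (_ * (_ + _))%E; apply: eq_unif => w w01 /=.
  rewrite evens_rec /odds dig_half0// dbl_half0// -/(odds w).
  by split=> -[? ?]; split=> //; lra.
rewrite evens_rec /odds dig_half1// dbl_half1// -/(odds w).
by split=> -[? ?]; split=> //; lra.
Qed.

Let J x y := fine (joint x y).

Let J_rec x y : J x y = 2^-1 * (J y (2 * x) + J y (2 * x - 1)).
Proof.
have jf a b : joint a b \is a fin_num by apply: unif_fin; exact: measurable_joint.
by rewrite /J joint_rec fineM ?fin_numD ?jf// fineD ?jf.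
Qed.

Let J_ge0 x y : 0 <= J x y.
Proof. by apply: fine_ge0; exact: measure_ge0. Qed.

Let J_le1 x y : J x y <= 1.
Proof.
rewrite -lee_fin /J -unif_fine; last exact: measurable_joint.
by apply: unif_le1; exact: measurable_joint.
Qed.

Let J_0 x y : y <= 0 -> J x y = 0.
Proof.
move=> y0; rewrite /J /joint (_ : [set _ | _] = set0) ?measure0//.
apply/seteqP; split=> // u /= [_]; rewrite ltNge => /negP; apply.
by apply: le_trans y0 _; exact: evens_ge0.
Qed.

(** The inequality is strict because [evens] can take the value 1. From here on the argument 2 means
    that no condition is imposed. *)
Let J_1 x y : 1 < y -> J x y = J x 2.
Proof.
move=> y1; congr (fine (unif _)); apply/seteqP.
by split=> u /= [ux _]; split=> //; apply: le_lt_trans (evens_le1 _) _ => //; rewrite ltr1n.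
Qed.

Let J2 z : J 2 z = J z 2.
Proof.
rewrite J_rec [J z (2 * 2)]J_1; last by lra.
rewrite [J z (2 * 2 - 1)]J_1; last by lra.
by lra.
Qed.

Let J22 : J 2 2 = 1.
Proof.
rewrite /J /joint (_ : [set _ | _] = setT) ?unifT//.
by apply/seteqP; split=> // u _; split;
  apply: le_lt_trans (evens_le1 _) _; rewrite ltr1n.
Qed.

(** One of the two terms of the recursion is always known: for [z] at most 1/2 the second is 0,
    beyond 1/2 the first is 1. The error at [z] is thus half an error at another point, for every
    [z], hence 0. *)
Let J_marginal z : J z 2 = clamp z.
Proof.
apply/eqP; rewrite -subr_eq0; apply/eqP/eq0_le_geometric => n.
elim: n z => [|n IH] z.
  rewrite expr0 ler_norml; have := J_ge0 z 2; have := J_le1 z 2.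
  by have := clamp_ge0 z; have := clamp_le1 z; lra.
rewrite J_rec !J2 clamp_halve exprS.
have [z2|z2] := leP z 2^-1.
  rewrite -[J (2 * z - 1) 2]J2 (J_0 2 (y := 2 * z - 1)); last by lra.
  rewrite (@clamp_le0 (2 * z - 1)); last by lra.
  rewrite !addr0 -mulrBr normrM ger0_norm ?invr_ge0//.
  by apply: ler_wpM2l; rewrite ?invr_ge0.
rewrite -[J (2 * z) 2]J2 (J_1 2 (y := 2 * z)) ?J22; last by lra.
rewrite (@clamp_ge1 (2 * z)); last by lra.
rewrite -mulrBr opprD addrACA subrr add0r normrM ger0_norm ?invr_ge0//.
by apply: ler_wpM2l; rewrite ?invr_ge0.
Qed.

(** Same scheme: for [x] at most 1/2 the second term of the recursion vanishes, beyond 1/2 the first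
    is the marginal, and half the error at a point with first coordinate [y] remains. *)
Let J_clamp x y : J x y = clamp x * clamp y.
Proof.
apply/eqP; rewrite -subr_eq0; apply/eqP/eq0_le_geometric => n.
elim: n x y => [|n IH] x y.
  rewrite expr0 ler_norml; have := J_ge0 x y; have := J_le1 x y.
  have := clamp_ge0 x; have := clamp_le1 x.
  by have := clamp_ge0 y; have := clamp_le1 y; nra.
rewrite J_rec (clamp_halve x) exprS.
have E (a b c : R) : 2^-1 * (a + b) - 2^-1 * (c : R) = 2^-1 * (a + b - c) by rewrite mulrBr.
rewrite -mulrA E normrM ger0_norm ?invr_ge0//.
apply: ler_wpM2l; rewrite ?invr_ge0//.
have [x2|x2] := leP x 2^-1.
  rewrite (J_0 y (y := 2 * x - 1)); last by lra.
  rewrite (@clamp_le0 (2 * x - 1)); last by lra.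
  by rewrite !addr0 [clamp _ * clamp _]mulrC.
rewrite (J_1 y (y := 2 * x)) ?J_marginal; last by lra.
rewrite (@clamp_ge1 (2 * x)); last by lra.
have -> : clamp y + J y (2 * x - 1) - (1 + clamp (2 * x - 1)) * clamp y
  = J y (2 * x - 1) - clamp y * clamp (2 * x - 1) by ring.
exact: IH.
Qed.

(** From rays to Borel sets one factor at a time: first with a ray for [odds], both sides being
    measures in [A]; then with [A] fixed, both sides being measures in [B]. *)
Lemma unif_evens_odds (A B : set Rm) : measurable A -> measurable B ->
  unif (evens @^-1` A `&` odds @^-1` B) = (unif A * unif B)%E.
Proof.
have mpre (f : Rm -> Rm) (C : set Rm) : measurable_fun setT f -> measurable C ->
  measurable (f @^-1` C) by move=> mf mC; rewrite -[X in measurable X]setTI; exact: mf.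
have ray (y : R) (C : set Rm) : measurable C ->
    unif (evens @^-1` C `&` odds @^-1` `]-oo, y[%classic) = (unif C * (clamp y)%:E)%E.
  move=> mC; rewrite muleC.
  have mD : measurable (odds @^-1` `]-oo, y[%classic : set Rm).
    by apply: mpre; [exact: measurable_odds|exact: measurable_itv].
  pose m1 := image_measure (mrestr unif mD) measurable_evens.
  pose m2 := mscale (NngNum (clamp_ge0 y)) unif.
  change (m1 C = m2 C); apply: real_measure_unique mC => x.
    change (unif (evens @^-1` `]-oo, x[%classic `&` odds @^-1` `]-oo, y[%classic)
      = ((clamp y)%:E * unif `]-oo, x[%classic)%E).
    rewrite unif_ray -EFinM mulrC -J_clamp /J -unif_fine; last exact: measurable_joint.
    by rewrite /joint; congr (unif _); apply/seteqP; split=> u /=; rewrite !in_itv.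
  apply: le_lt_trans (ltry 1); apply: unif_le1; apply: measurableI => //.
  by apply: mpre; [exact: measurable_evens|exact: measurable_itv].
move=> mA mB.
have mD : measurable (evens @^-1` A : set Rm) by apply: mpre => //; exact: measurable_evens.
pose m1 := image_measure (mrestr unif mD) measurable_odds.
have uA : 0 <= fine (unif A) by apply: fine_ge0; exact: measure_ge0.
pose m2 := mscale (NngNum uA) unif.
rewrite setIC (unif_fine mA); change (m1 B = m2 B).
apply: real_measure_unique mB => x.
  change (unif (odds @^-1` `]-oo, x[%classic `&` evens @^-1` A)
      = ((fine (unif A))%:E * unif `]-oo, x[%classic)%E).
  by rewrite setIC ray// unif_ray -unif_fine.
apply: le_lt_trans (ltry 1); apply: unif_le1; apply: measurableI => //.
by apply: mpre; [exact: measurable_odds|exact: measurable_itv].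
Qed.

End UniformOnR.

(** * Independent uniform labels *)

Section UniformOnUnitInterval.
Context {R : realType}.
Local Notation Rm := (measurableTypeR R).
Local Notation U := (unit_interval R).
Local Notation lambda := (@lebesgue_measure R).

Definition to_unit (x : R) : U := Itv01 (clamp_ge0 x) (clamp_le1 x).

Lemma to_unitK (x : R) : unit_val (to_unit x) = clamp x.
Proof. by []. Qed.

Lemma unit_val_itv (u : U) : 0 <= unit_val u <= 1.
Proof. by rewrite /unit_val; apply/andP; split. Qed.

Lemma clamp_id (x : R) : 0 <= x <= 1 -> clamp x = x.
Proof. by case: (clampE x) => -[] *; lra. Qed.

Lemma measurable_unit_val : measurable_fun setT (@unit_val R : U -> Rm).
Proof. by move=> _ B mB; exists B. Qed.

Lemma measurable_clamp : measurable_fun setT (clamp : Rm -> Rm).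
Proof.
apply: measurable_maxr; first exact: measurable_cst.
by apply: measurable_minr; [exact: measurable_cst|exact: measurable_id].
Qed.

Lemma measurable_to_unit : measurable_fun setT (to_unit : Rm -> U).
Proof.
move=> _ _ [B mB <-]; rewrite setTI.
have := measurable_clamp measurableT mB; rewrite setTI.
by congr measurable; apply/seteqP; split=> x //= [].
Qed.

Definition unif01 : set U -> \bar R := image_measure unif measurable_to_unit.

HB.instance Definition _ := Measure.on unif01.

Let unif01T : unif01 setT = 1%E.
Proof. by rewrite /unif01 /image_measure preimage_setT unifT. Qed.

HB.instance Definition _ := Measure_isProbability.Build _ _ _ unif01 unif01T.

(** [uniform_law] sees the closed interval while [unif] lives on the half-open one; the endpoint 1
    is a null set. *)
Lemma uniform_lawE (B : set U) : measurable B -> uniform_law B = unif01 B.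
Proof.
move=> [C mC <-]; rewrite setTI /uniform_law /unif01 /image_measure unifE.
have -> : @unit_val R @` (@unit_val R @^-1` C) = (C `&` `[0, 1[%classic) `|` (C `&` [set 1]).
  apply/seteqP; split=> [_ [u Cu <-]|x] /=.
    have /andP[u0 u1] := unit_val_itv u.
    by move: u1; rewrite le_eqVlt => /predU1P[u1|u1]; [right|left; rewrite in_itv /= u0].
  move=> h; exists (to_unit x); last first.
    by rewrite to_unitK clamp_id//; case: h => -[_]; rewrite /= ?in_itv /=; lra.
  rewrite to_unitK clamp_id; first by case: h => -[].
  by case: h => -[_]; rewrite /= ?in_itv /=; lra.
rewrite measureU0; last first.
- apply/eqP; rewrite eq_le measure_ge0 andbT -(lebesgue_measure_set1 (1 : R)).
  apply: le_measure; rewrite ?inE; [exact: measurableI|exact: measurable_set1|].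
  exact: subIsetr.
- exact: measurableI.
- by apply: measurableI => //; exact: measurable_itv.
congr (lambda _); apply/seteqP; split=> x /= [Cx]; rewrite in_itv /= => x01; split=> //.
  by rewrite clamp_id//; lra.
by move: Cx; rewrite clamp_id//; lra.
Qed.

Definition evens01 (u : U) : U := to_unit (evens (unit_val u)).
Definition odds01 (u : U) : U := to_unit (odds (unit_val u)).

Lemma measurable_evens01 : measurable_fun setT evens01.
Proof.
apply: measurableT_comp measurable_to_unit _.
exact: measurableT_comp measurable_evens measurable_unit_val.
Qed.

Lemma measurable_odds01 : measurable_fun setT odds01.
Proof.
apply: measurableT_comp measurable_to_unit _.
exact: measurableT_comp measurable_odds measurable_unit_val.
Qed.

Lemma measurable_preimage d1 d2 (T1 : measurableType d1) (T2 : measurableType d2)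
    (f : T1 -> T2) (B : set T2) :
  measurable_fun setT f -> measurable B -> measurable (f @^-1` B).
Proof. by move=> mf mB; rewrite -[X in measurable X]setTI; exact: mf. Qed.

Lemma unif01_split (A B : set U) : measurable A -> measurable B ->
  unif01 (evens01 @^-1` A `&` odds01 @^-1` B) = (unif01 A * unif01 B)%E.
Proof.
move=> mA mB; rewrite [X in (X * _)%E]/unif01 [X in (_ * X)%E]/unif01 /image_measure.
rewrite -unif_evens_odds; try exact: measurable_preimage measurable_to_unit _.
rewrite /unif01 /image_measure; apply: eq_unif => w w01 /=.
by rewrite /evens01 /odds01 to_unitK clamp_id//; lra.
Qed.

(* Splitting the binary digits of [u] again and again into two halves yields
   independent uniform variables [stream 0 u], [stream 1 u], ... *)
Fixpoint stream n (u : U) : U :=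
  if n is n'.+1 then stream n' (odds01 u) else evens01 u.

Lemma measurable_stream n : measurable_fun setT (stream n).
Proof.
elim: n => [|n IH]; first exact: measurable_evens01.
exact: measurableT_comp IH measurable_odds01.
Qed.

Lemma unif01_stream N (B : nat -> set U) : (forall n, measurable (B n)) ->
  unif01 [set u | forall n, (n < N)%N -> B n (stream n u)]
  = (\prod_(n < N) unif01 (B n))%E.
Proof.
elim: N B => [|N IH] B mB.
  by rewrite big_ord0 -unif01T; congr unif01; apply/seteqP; split.
rewrite big_ord_recl -(IH (B \o S))//=.
have mN : measurable [set u | forall n, (n < N)%N -> (B \o S) n (stream n u)].
  have -> : [set u | forall n, (n < N)%N -> (B \o S) n (stream n u)]
    = \bigcap_(n in [set n | (n < N)%N]) (stream n @^-1` B n.+1) by [].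
  apply: bigcap_measurableType => n _.
  exact: measurable_preimage (measurable_stream n) _.
rewrite -unif01_split//; congr unif01; apply/seteqP; split=> u /=.
  by move=> h; split; [exact: (h 0%N)|move=> n nN; exact: (h n.+1)].
by move=> [h0 h] [|n]; [|exact: h].
Qed.

Lemma unif01_stream_seq (s : seq nat) (B : nat -> set U) : uniq s ->
  (forall n, measurable (B n)) ->
  unif01 [set u | {in s, forall n, B n (stream n u)}]
  = (\prod_(n <- s) unif01 (B n))%E.
Proof.
move=> us mB; pose N := (\max_(n <- s) n).+1.
have sN n : n \in s -> (n < N)%N by move=> ns; rewrite ltnS; exact: leq_bigmax_seq.
pose B' n := if n \in s then B n else setT.
have -> : [set u | {in s, forall n, B n (stream n u)}]
    = [set u | forall n, (n < N)%N -> B' n (stream n u)].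
  apply/seteqP; split=> u /= h n; rewrite /B'.
    by move=> _; case: ifP => // /h.
  by move=> ns; have := h n (sN n ns); rewrite /B' ns.
rewrite unif01_stream; last by move=> n; rewrite /B'; case: ifP.
rewrite -(big_mkord xpredT (fun n => unif01 (B' n))) (bigID (mem s))/=.
rewrite [X in (_ * X)%E]big1 => [|n /negbTE ns]; last by rewrite /B' ns unif01T.
rewrite mule1 -big_filter; rewrite (perm_big s).
  by apply: eq_big_seq => n ns; rewrite /B' ns.
apply: uniq_perm => [||n] //; first by rewrite filter_uniq ?iota_uniq.
by rewrite mem_filter mem_index_iota /=; case: (boolP (n \in s)) => // /sN.
Qed.

Lemma unif01_stream_code (J : countType) (s : seq J) (B : J -> set U) : uniq s ->
  (forall j, measurable (B j)) ->
  unif01 [set u | {in s, forall j, B j (stream (choice.pickle j) u)}]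
  = (\prod_(j <- s) unif01 (B j))%E.
Proof.
move=> us mB; pose B' n := oapp B setT (choice.unpickle n).
transitivity (unif01 [set u | {in map choice.pickle s, forall n, B' n (stream n u)}]).
  congr unif01; apply/seteqP; split=> u /= h.
    by move=> _ /mapP[j js ->]; rewrite /B' choice.pickleK /=; exact: h.
  by move=> j js; have := h _ (map_f _ js); rewrite /B' choice.pickleK.
rewrite unif01_stream_seq.
- by rewrite big_map; apply: eq_bigr => j _; rewrite /B' choice.pickleK.
- by rewrite map_inj_uniq//; exact: pcan_inj choice.pickleK.
- by move=> n; rewrite /B'; case: choice.unpickle => [j|] /=; [exact: mB|exact: measurableT].
Qed.

End UniformOnUnitInterval.

Section ConfigurationSpace.
Context (V : Type) d (M : measurableType d).
Local Notation C := (configuration V M).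

Lemma measurable_coordinate (v : V) :
  measurable_fun setT (fun x : C => x v : M).
Proof.
by move=> _ B mB; rewrite setTI; apply: sub_sigma_algebra; exists v, B.
Qed.

Lemma measurable_configuration d' (T : measurableType d') (f : T -> C) :
  (forall v, measurable_fun setT (fun t => f t v : M)) -> measurable_fun setT f.
Proof.
move=> mf; apply: (@measurability _ _ T C setT f (@cylinders V d M)) => //.
move=> _ [_ [v [B [mB ->]]] <-]; rewrite setTI.
exact: measurable_preimage (mf v) mB.
Qed.

End ConfigurationSpace.

Section IidLabels.
Context (d : nat) (R : realType).
Local Notation U := (unit_interval R).
Local Notation L := (labelling d R).

(** The infinite product law is realised as the image of the uniform law on [0,1]: the digits of one
    number provide the labels of all vertices. *)
Definition spread (u : U) : L := fun v => stream (choice.pickle v) u.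

Lemma measurable_spread : measurable_fun setT spread.
Proof. by apply: measurable_configuration => v; exact: measurable_stream. Qed.

Definition iid_law : set L -> \bar R := image_measure unif01 measurable_spread.

HB.instance Definition _ := Measure.on iid_law.

Let iid_lawT : iid_law setT = 1%E.
Proof. exact: (@probability_setT _ _ _ unif01). Qed.

HB.instance Definition _ := Measure_isProbability.Build _ _ _ iid_law iid_lawT.

Lemma iid_law_uniform : iid_uniform iid_law.
Proof.
move=> F B mB.
rewrite -[LHS]/(unif01 [set u | {in enum_fset F, forall v,
  B v (stream (choice.pickle v) u)}]).
rewrite unif01_stream_code ?fset_uniq//; apply: eq_bigr => v _.
by rewrite uniform_lawE.
Qed.

(** Each label is split once more, by time and layer only. The vertex part of a coordinate is
    untouched, so an automorphism acting on the labelling moves the noise in the same way. *)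
Definition field (x : L) (i : (nat * nat) * vertex d) : U :=
  stream (choice.pickle i.1) (x i.2).

Lemma measurable_field i : measurable_fun setT (field ^~ i).
Proof.
exact: measurableT_comp (measurable_stream _) (@measurable_coordinate _ _ _ i.2).
Qed.

(** Group the coordinates by vertex: different vertices are independent by [iid_law_uniform], and
    the fields at one vertex by the independence of the [stream] of its label. *)
Lemma iid_law_field (s : seq ((nat * nat) * vertex d))
    (B : (nat * nat) * vertex d -> set U) : uniq s -> (forall i, measurable (B i)) ->
  iid_law [set x | {in s, forall i, B i (field x i)}]
  = (\prod_(i <- s) unif01 (B i))%E.
Proof.
move=> us mB; pose F := [fset i.2 | i in s]%fset.
pose sv v := [seq i.1 | i <- s & i.2 == v].
pose BF v := [set u : U | {in sv v, forall j, B (j, v) (stream (choice.pickle j) u)}].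
have usv v : uniq (sv v).
  rewrite map_inj_in_uniq ?filter_uniq// => -[a w] [b w'].
  by rewrite !mem_filter /= => /andP[/eqP -> _] /andP[/eqP -> _] ->.
have mBF v : measurable (BF v).
  have -> : BF v = \bigcap_(j in [set j | j \in sv v])
      (stream (choice.pickle j) @^-1` B (j, v)) by [].
  apply: fin_bigcap_measurable => [|j _]; first exact: finite_seq.
  exact: measurable_preimage (measurable_stream _) _.
have -> : [set x | {in s, forall i, B i (field x i)}]
    = [set x : L | forall v, v \in F -> BF v (x v)].
  apply/seteqP; split=> x /= h.
    move=> v _ j /mapP[[k w]]; rewrite mem_filter /= => /andP[/eqP -> ks] ->.
    exact: (h _ ks).
  move=> [j v] js; apply: (h v); first by apply/imfsetP; exists (j, v).
  by apply/mapP; exists (j, v) => //; rewrite mem_filter eqxx.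
rewrite iid_law_uniform//.
have PBF v : uniform_law (BF v) = (\prod_(i <- s | i.2 == v) unif01 (B i))%E.
  rewrite uniform_lawE// [LHS](unif01_stream_code (B := fun j => B (j, v)))//.
  by rewrite big_map big_filter; apply: eq_bigr => -[j w] /= /eqP ->.
under eq_bigr do rewrite PBF.
rewrite (exchange_big_dep xpredT)//=; apply: eq_big_seq => -[j v] js /=.
rewrite (big_rem v)/=; last by apply/imfsetP; exists (j, v).
rewrite eqxx big1_seq ?mule1// => w /andP[/eqP <-].
by rewrite mem_rem_uniqF// fset_uniq.
Qed.

End IidLabels.

(** * Decoding the labels *)

Section FiniteValued.
Context dT (T : measurableType dT) (A : finType) (X : T -> A).
Hypothesis mX : forall a, measurable [set t | X t = a].

Lemma measurable_finite_valued (B : set A) : measurable [set t | B (X t)].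
Proof.
have -> : [set t | B (X t)] = \bigcup_(a in B) [set t | X t = a].
  by apply/seteqP; split=> t /=; [move=> Bt; exists (X t)|move=> [a Ba /= ->]].
by apply: fin_bigcup_measurable => //; exact: finite_finset.
Qed.

Lemma measure_fibers (R : realType) (mu : {measure set T -> \bar R}) (E : set T) :
  measurable E -> mu E = (\sum_a mu (E `&` [set t | X t = a]))%E.
Proof.
move=> mE.
have h (s : seq A) : uniq s ->
    mu (E `&` [set t | X t \in s]) = (\sum_(a <- s) mu (E `&` [set t | X t = a]))%E.
  elim: s => [_|a s IH /= /andP[nas us]].
    rewrite big_nil -[RHS](measure0 mu); congr (mu _).
    by apply/seteqP; split=> t [].
  rewrite big_cons -IH// -measureU.
  - congr (mu _); rewrite -setIUr; congr (_ `&` _).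
    apply/seteqP; split=> t /=; rewrite inE.
      by move=> /predU1P.
    by move=> h; apply/predU1P.
  - exact: measurableI.
  - apply: measurableI => //; exact: (measurable_finite_valued [set a | a \in s]).
  - apply/seteqP; split=> // t [[_ /= ->] [_ /=]].
    by rewrite (negbTE nas).
rewrite -[RHS]h ?index_enum_uniq//; congr (mu _).
by apply/seteqP; split=> t /= => [Et|[]//]; split=> //=; rewrite mem_index_enum.
Qed.

Lemma sum_law (R : realType) (P : probability T R) (b : A -> bool) :
  \sum_a fine (P [set t | X t = a]) * (b a)%:R = fine (P [set t | b (X t)]).
Proof.
apply: EFin_inj; have mb := measurable_finite_valued [set a | b a].
rewrite fineK; last exact: fin_num_measure.
rewrite measure_fibers; last exact: mb.
rewrite -sumEFin; apply: eq_bigr => a _.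
rewrite EFinM fineK; last exact: fin_num_measure.
case ba : (b a); rewrite ?mule1 ?mule0.
  congr (P _); apply/seteqP; split=> t /=; last by case.
  by move=> Xt; split=> //=; rewrite Xt ba.
rewrite -[LHS](measure0 P); congr (P _); apply/seteqP; split=> // t /= [].
by move=> bt Xt; rewrite Xt ba in bt.
Qed.

End FiniteValued.

Lemma measurable_local dT (T : measurableType dT) (I : choiceType) (A : finType)
    (X : T -> I -> A) (E : (I -> A) -> Prop) :
  (forall i a, measurable [set t | X t i = a]) ->
  local E -> measurable [set t | E (X t)].
Proof.
move=> mX [s]; elim: s E => [|i s IH] E dE.
  have [h|h] := pselect (exists t, E (X t)).
    have [t Et] := h; have -> : [set t | E (X t)] = setT; last exact: measurableT.
    by apply/seteqP; split=> // t' _ /=; rewrite (dE _ (X t)).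
  have -> : [set t | E (X t)] = set0; last exact: measurable0.
  by apply/seteqP; split=> // t Et; apply: h; exists t.
have -> : [set t | E (X t)]
    = \bigcup_(a in [set: A]) ([set t | X t i = a] `&` [set t | E (upd (X t) i a)]).
  apply/seteqP; split=> t /=.
    by move=> Et; exists (X t i) => //; split => //=; rewrite upd_id.
  by move=> [a _ [/= <-]]; rewrite upd_id.
apply: fin_bigcup_measurable => [|a _]; first exact: finite_finset.
apply: measurableI => //; apply: (IH (fun c => E (upd c i a))) => c c' cc'.
apply: dE => j; rewrite inE /upd; case: eqP => //= _; exact: cc'.
Qed.

Section InverseCdf.
Context (R : realType) (S : pointedFinType).
Implicit Types (K : S -> R) (l : seq S).

(* [u] falls in the interval of length [K s] attached to [s] when the intervals
   are laid end to end from [0] in the order of [l]. *)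
Fixpoint inverse_cdf K l (u : R) : discrete S :=
  if l is s :: l' then
    if u < K s then s else inverse_cdf K l' (u - K s)
  else point.

Lemma measurable_inverse_cdf K l :
  measurable_fun setT (inverse_cdf K l : measurableTypeR R -> discrete S).
Proof.
elim: l => [|s l IH] /=; first exact: measurable_cst.
apply: measurable_fun_ifT => //.
- by apply: measurable_fun_ltr; [exact: measurable_id|exact: measurable_cst].
- apply: (measurableT_comp IH); apply: measurable_funB; first exact: measurable_id.
  exact: measurable_cst.
Qed.

Lemma inverse_cdf_mem K l (u : R) : u < \sum_(s <- l) K s -> 0 <= u ->
  inverse_cdf K l u \in l.
Proof.
elim: l u => [|s l IH] u /=; first by rewrite big_nil ltNge => /negP h /h.
rewrite big_cons inE => ul u0; case: ltP => us; first by rewrite eqxx.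
by rewrite IH ?orbT//; lra.
Qed.

Lemma inverse_cdf_itv K l (u : R) s : (forall s, 0 <= K s) -> uniq l -> s \in l ->
  0 <= u < \sum_(t <- l) K t ->
  (inverse_cdf K l u == s)
  = (\sum_(t <- take (index s l) l) K t <= u < \sum_(t <- take (index s l) l) K t + K s).
Proof.
move=> K0; elim: l u => //= t l IH u /andP[tl ul]; rewrite inE big_cons => sl /andP[u0 us].
have [ts|ts] := eqVneq t s.
  rewrite big_nil add0r u0 -ts /=; case: ltP => ut; first by rewrite eqxx.
  apply/negbTE; apply: contraNneq tl => <-; apply: inverse_cdf_mem; lra.
have {}sl : s \in l by move: sl; rewrite eq_sym (negbTE ts).
rewrite big_cons; set c := \sum_(t <- _) _.
have c0 : 0 <= c by apply: sumr_ge0.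
case: ltP => ut; first by rewrite (negbTE ts); symmetry; apply/negbTE; lra.
rewrite IH//; last by lra.
by rewrite -/c; apply/idP/idP; lra.
Qed.

Lemma unif_inverse_cdf K s : is_law K ->
  unif [set w | inverse_cdf K (enum S) w = s] = (K s)%:E.
Proof.
move=> [K0 K1]; have sE : \sum_(t <- enum S) K t = 1 by rewrite big_enum.
have sS : s \in enum S by rewrite mem_enum.
pose c := \sum_(t <- take (index s (enum S)) (enum S)) K t.
have c0 : 0 <= c by apply: sumr_ge0.
have c1 : c + K s <= 1.
  rewrite -sE -[X in \sum_(t <- X) _](cat_take_drop (index s (enum S))) big_cat /= lerD2l.
  rewrite (drop_nth s) ?index_mem// nth_index// big_cons lerDl.
  exact: sumr_ge0.
rewrite unifE.
have -> : [set w | inverse_cdf K (enum S) w = s] `&` `[0, 1[%classic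
    = `[c, (c + K s)[%classic.
  apply/seteqP; split=> w /=; rewrite !in_itv /=.
    move=> [/eqP h w01]; move: h.
    by rewrite inverse_cdf_itv ?enum_uniq ?sE.
  move=> wc; have w01 : 0 <= w < 1 by lra.
  by split=> //; apply/eqP; rewrite inverse_cdf_itv ?enum_uniq ?sE.
rewrite lebesgue_measure_itv /= lte_fin ltrDl.
have [Ks|Ks] := ltP 0 (K s); first by rewrite -EFinD; congr EFin; ring.
by congr EFin; apply/eqP; rewrite eq_le K0 Ks.
Qed.

End InverseCdf.

Section Decoding.
Context (R : realType) (d : nat) (S : pointedFinType) (pi : S -> R) (Q : S -> S -> R).
Hypothesis hQ : reversible_chain pi Q.
Hypothesis hB : forall w : {ffun 'I_d -> S}, 0 < nbhd_prob pi Q w.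
Local Notation noise := (noise d S).
Local Notation coordinate := (coordinate d).
Local Notation U := (unit_interval R).
Local Notation L := (labelling d R).

(** Bit and answers come from one number and are dependent. This is harmless: layer 0 is read for
    bits only, the other layers for answers only, and the dynamics uses only the law of each single
    answer and of the bit. *)
Definition decode (u : U) : noise :=
  (unit_val u < 2^-1, [ffun r => inverse_cdf (request_law pi Q r) (enum S) (unit_val u)]).

Lemma measurable_answer r s : measurable [set u | answer (decode u) r = s].
Proof.
have -> : [set u | answer (decode u) r = s]
    = @unit_val R @^-1` (inverse_cdf (request_law pi Q r) (enum S) @^-1` [set s]).
  by apply/seteqP; split=> u /=; rewrite /answer ffunE.
apply: measurable_preimage; first exact: measurable_unit_val.
by apply: measurable_preimage => //; exact: measurable_inverse_cdf.
Qed.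

Lemma measurable_decode_bit : measurable [set u : U | (decode u).1].
Proof.
have -> : [set u : U | (decode u).1] = @unit_val R @^-1` `]-oo, 2^-1[%classic.
  by apply/seteqP; split=> u /=; rewrite in_itv.
by apply: measurable_preimage; [exact: measurable_unit_val|exact: measurable_itv].
Qed.

Lemma measurable_decode phi : measurable [set u | decode u = phi].
Proof.
have -> : [set u | decode u = phi] = [set u : U | (decode u).1 = phi.1]
    `&` \bigcap_(r in [set: request d S]) [set u | answer (decode u) r = answer phi r].
  apply/seteqP; split=> u /=; first by move=> <-; split.
  case: phi => b f [h1 h2]; congr pair => //.
  by apply/ffunP => r; exact: (h2 r).
apply: measurableI.
  case: (phi.1); first exact: measurable_decode_bit.
  have -> : [set u : U | (decode u).1 = false] = ~` [set u : U | (decode u).1].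
    by apply/seteqP; split=> u /= => [->//|/negP/negbTE].
  exact: measurableC measurable_decode_bit.
apply: fin_bigcap_measurable => [|r _]; first exact: finite_finset.
exact: measurable_answer.
Qed.

Definition noise_law (phi : noise) : R := fine (unif01 [set u | decode u = phi]).

Lemma noise_law_ge0 phi : 0 <= noise_law phi.
Proof. by apply: fine_ge0; exact: measure_ge0. Qed.

Lemma noise_law_sum (b : noise -> bool) :
  \sum_phi noise_law phi * (b phi)%:R = fine (unif01 [set u | b (decode u)]).
Proof. exact: (sum_law measurable_decode [the probability _ _ of unif01]). Qed.

Lemma noise_law_sum1 : \sum_phi noise_law phi = 1.
Proof.
transitivity (\sum_phi noise_law phi * true%:R).
  by apply: eq_bigr => phi _; rewrite mulr1.
rewrite noise_law_sum (_ : [set _ | _] = setT); last by apply/seteqP.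
by rewrite probability_setT.
Qed.

Lemma noise_law_answer r s :
  \sum_phi noise_law phi * (answer phi r == s)%:R = request_law pi Q r s.
Proof.
rewrite (noise_law_sum (fun phi => answer phi r == s)).
rewrite -[RHS]/(fine (request_law pi Q r s)%:E); congr fine.
rewrite -(unif_inverse_cdf s (request_law_is_law r hQ hB)).
apply: eq_unif => w w01; rewrite /= /answer ffunE to_unitK clamp_id; last by lra.
by split=> [/eqP|->].
Qed.

Lemma noise_law_coin : \sum_phi noise_law phi * phi.1%:R = 2^-1.
Proof.
rewrite (noise_law_sum (fun phi => phi.1)) -[RHS]/(fine (2^-1 : R)%:E); congr fine.
rewrite -[in RHS](@clamp_id _ (2^-1 : R)); last by lra.
rewrite -unif_ray; apply: eq_unif => w w01.
by rewrite /= in_itv /unit_val /= clamp_id; lra.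
Qed.

Definition noise_of (x : L) : coordinate -> noise := fun i => decode (field x i).

Lemma measurable_noise_of i phi : measurable [set x : L | noise_of x i = phi].
Proof.
exact: measurable_preimage (measurable_field i) (measurable_decode phi).
Qed.

Lemma measurable_noise_local (E : (coordinate -> noise) -> Prop) : local E ->
  measurable [set x : L | E (noise_of x)].
Proof. by apply: measurable_local; exact: measurable_noise_of. Qed.

Lemma iid_law_noise (t : seq coordinate) (c : coordinate -> noise) : uniq t ->
  iid_law [set x : L | {in t, forall i, noise_of x i = c i}]
  = (\prod_(i <- t) noise_law (c i))%:E.
Proof.
move=> ut; rewrite [LHS](@iid_law_field d R t (fun i => [set u | decode u = c i]))//;
  last by move=> i; exact: measurable_decode.
elim: t {ut} => [|i t IH]; first by rewrite !big_nil.
rewrite !big_cons EFinM -IH; congr (_ * _)%E; rewrite fineK//.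
by apply: fin_num_measure; exact: measurable_decode.
Qed.

(** The coordinates in [t] are already fixed to [c], those in [s] still have to be summed. The
    induction splits the event according to the noise at the head of [s] and moves that index to
    [t]. *)
Lemma iid_law_local_aux (s t : seq coordinate) (E : (coordinate -> noise) -> bool) c :
  uniq (s ++ t) -> depends (s ++ t) E ->
  iid_law [set x : L | {in t, forall i, noise_of x i = c i} /\ E (noise_of x)]
  = (\prod_(i <- t) noise_law (c i) * isum noise_law s (fun c => (E c)%:R) c)%:E.
Proof.
elim: s t c => [|i s IH] t c.
  move=> ut dE /=; case Ec : (E c); rewrite ?mulr1 ?mulr0.
    rewrite -iid_law_noise//; congr iid_law; apply/seteqP; split=> x /= => [[]//|h].
    by split=> //; rewrite (dE _ c).
  rewrite -[RHS](measure0 [the measure _ _ of @iid_law d R]); congr iid_law.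
  by apply/seteqP; split=> // x /= [h]; rewrite (dE _ c)// Ec.
move=> ust dE; have /andP[it ust'] : (i \notin s ++ t) && uniq (s ++ t) by [].
have ust2 : uniq (s ++ i :: t).
  by rewrite (perm_uniq (s2 := i :: s ++ t))// -(cat1s i t) perm_catCA.
have dE2 : depends (s ++ i :: t) E.
  by apply: depends_sub dE => j; rewrite !(inE, mem_cat) orbCA.
have it' : i \notin t by move: it; rewrite mem_cat negb_or => /andP[].
rewrite (measure_fibers (measurable_noise_of i)); last first.
  apply: (measurable_noise_local (E := fun c' => {in t, c' =1 c} /\ E c')).
  exists (i :: s ++ t) => c1 c2 c12.
  rewrite (dE _ _ c12); congr (_ /\ _); apply/propext; split=> h j jt.
    by rewrite -c12 ?h// inE mem_cat jt !orbT.
  by rewrite c12 ?h// inE mem_cat jt !orbT.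
rewrite /= mulr_sumr -sumEFin; apply: eq_bigr => phi _.
rewrite mulrA [_ * noise_law phi]mulrC.
have -> : noise_law phi * \prod_(j <- t) noise_law (c j)
    = \prod_(j <- i :: t) noise_law (upd c i phi j).
  rewrite big_cons upd_same; congr (_ * _); apply: eq_big_seq => j jt.
  by rewrite upd_other//; apply: contraNneq it' => <-.
rewrite -IH//; congr iid_law; apply/seteqP; split=> x /=.
  move=> [[ht Ex] xi]; split=> // j; rewrite inE => /predU1P[->|jt].
    by rewrite upd_same.
  by rewrite upd_other ?ht//; apply: contraNneq it' => <-.
move=> [h Ex]; split; last by rewrite h ?inE ?eqxx// upd_same.
split=> // j jt; rewrite h ?inE ?jt ?orbT// upd_other//.
by apply: contraNneq it' => <-.
Qed.

(** The bridge from finite sums to measures: it turns the estimates on [expect] into estimates for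
    random labellings. *)
Lemma iid_law_local a0 (E : (coordinate -> noise) -> bool) : local E ->
  iid_law [set x : L | E (noise_of x)]
  = (expect noise_law a0 (fun c => (E c)%:R))%:E.
Proof.
move=> [s dE]; pose c : coordinate -> noise := fun=> a0.
have dE' : depends (undup s ++ [::]) E.
  by apply: depends_sub dE => i; rewrite cats0 mem_undup.
have dE2 : depends (undup s) (fun c => (E c)%:R : R).
  by move=> c1 c2 c12; rewrite (dE' c1 c2)// cats0.
rewrite (expectE noise_law_sum1 a0 c dE2).
have := @iid_law_local_aux (undup s) [::] E c; rewrite big_nil mul1r => <-//.
  by congr iid_law; apply/seteqP; split=> x //= [].
by rewrite cats0 undup_uniq.
Qed.

End Decoding.

(** * The limit process *)

Section ImageProbability.
Context d d' (T1 : measurableType d) (T2 : measurableType d') (R : realType).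
Context (P : probability T1 R) (f : T1 -> T2) (mf : measurable_fun setT f).

Let image_setT : image_measure P mf setT = 1%E.
Proof. exact: (probability_setT P). Qed.

HB.instance Definition _ := Measure_isProbability.Build _ _ _
  (image_measure P mf) image_setT.

End ImageProbability.

(** * Uniqueness of the branching Markov law *)

Section Uniqueness.
Context (R : realType) (d : nat) (S : pointedFinType) (pi : S -> R) (Q : S -> S -> R).
Local Notation C := (coloring d S).

Lemma measurable_color (v : vertex d) (a : S) : measurable [set y : C | y v = a].
Proof. by apply: sub_sigma_algebra; exists v, [set a]. Qed.

(** Fix the colours of the vertices of [s] one by one, splitting the event each time, until only
    full cylinders on [F] remain; their probabilities are prescribed. *)
Lemma branching_markov_local (nu1 nu2 : probability C R) (F : {fset vertex d})
    (s t : seq (vertex d)) (A : (vertex d -> S) -> Prop) (x : vertex d -> S) :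
  branching_markov pi Q nu1 -> branching_markov pi Q nu2 ->
  tree_closed F -> s ++ t =i F -> depends F A ->
  nu1 [set y : C | {in t, y =1 x} /\ A y] = nu2 [set y : C | {in t, y =1 x} /\ A y].
Proof.
move=> h1 h2 [rF pF] + dA; elim: s t x => [|v s IH] t x stF.
  have [Ax|nAx] := pselect (A x); last first.
    suff -> : [set y : C | {in t, y =1 x} /\ A y] = set0 by rewrite !measure0.
    apply/seteqP; split=> // y /= [yx]; rewrite (dA y x)// => v vF.
    by apply: yx; rewrite stF.
  have -> : [set y : C | {in t, y =1 x} /\ A y] = [set y | forall v, v \in F -> y v = x v].
    apply/seteqP; split=> y /= => [[yx _] v vF|yx]; first by apply: yx; rewrite stF.
    split; last by rewrite (dA y x).
    by move=> v vt; apply: yx; rewrite -stF.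
  by rewrite h1// h2.
have [vt|vt] := boolP (v \in t).
  apply: IH => w; rewrite -stF inE mem_cat.
  by case: eqVneq => [->|//]; rewrite vt orbT.
have mE : measurable [set y : C | {in t, y =1 x} /\ A y].
  apply: (measurable_local (X := fun y : C => y) (E := fun y => {in t, y =1 x} /\ A y)).
    exact: measurable_color.
  exists F => y y' yy'; rewrite (dA _ _ yy'); congr (_ /\ _); apply/propext.
  by split=> h w wt; rewrite -h// yy'// -stF mem_cat wt !orbT.
rewrite (measure_fibers (measurable_color v) nu1 mE).
rewrite (measure_fibers (measurable_color v) nu2 mE).
apply: eq_bigr => a _.
have -> : [set y : C | {in t, y =1 x} /\ A y] `&` [set y | y v = a]
    = [set y : C | {in v :: t, y =1 upd x v a} /\ A y].
  apply/seteqP; split=> y /=.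
    move=> [[yx Ay] yv]; split=> // w; rewrite inE /upd; case: eqVneq => [->//|_] /=.
    exact: yx.
  move=> [yx Ay]; split; last by rewrite yx ?inE ?eqxx// upd_same.
  split=> // w wt; rewrite yx ?inE ?wt ?orbT// upd_other//.
  by apply: contraNneq vt => <-.
apply: IH => w; rewrite -stF !(inE, mem_cat).
by rewrite orbCA.
Qed.

(** Local events are stable under intersection and generate the product sigma-algebra; each depends
    on a tree-closed finite set, where [branching_markov_local] applies. *)
Lemma branching_markov_unique (nu1 nu2 : probability C R) :
  branching_markov pi Q nu1 -> branching_markov pi Q nu2 ->
  forall A, measurable A -> nu1 A = nu2 A.
Proof.
move=> h1 h2; pose G : set (set C) := [set A | local (A : (vertex d -> S) -> Prop)].
have Gm : G `<=` @measurable _ C.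
  by move=> A lA; apply: (measurable_local (X := fun y : C => y) measurable_color lA).
have GT : G setT by exact: local_cst.
refine (@measure_unique _ R C G (fun=> setT) _ _ _ _ nu1 nu2 _ _) => //.
- rewrite eqEsubset; split; last exact: smallest_sub (sigma_algebra_measurable _) Gm.
  apply: smallest_sub; first exact: smallest_sigma_algebra.
  move=> _ [v [B [_ ->]]]; apply: sub_sigma_algebra.
  by apply: (local_comp (fun a => B a)); exact: local_coord.
- by move=> A B lA lB; apply: (local_comp2 and).
- exact: bigcup_const.
- move=> A [s dA]; have [F cF sF] := tree_closure s.
  have := @branching_markov_local nu1 nu2 F F [::] A (fun=> point) h1 h2 cF.
  have -> : [set y : C | {in [::], y =1 fun=> point} /\ A y] = A.
    by apply/seteqP; split=> y //= [].
  apply; first by rewrite cats0.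
  exact: depends_sub dA.
- by move=> k; rewrite [X in (X < _)%E](probability_setT nu1) ltry.
Qed.

End Uniqueness.

Section Eventual.
Context (S : pointedFinType).

(** A limit in a discrete space, made total by a default that refers to no vertex, so that the
    factor map is defined and equivariant everywhere and not just almost surely. *)
Definition eventual (u : nat -> S) : S :=
  if pselect (exists s n, forall k, (n <= k)%N -> u k = s) is left h
  then projT1 (cid h) else point.

Lemma eventualE u s n : (forall k, (n <= k)%N -> u k = s) -> eventual u = s.
Proof.
move=> us; rewrite /eventual; case: pselect => [h|]; last by case; exists s, n.
case: cid => /= t [m mt]; rewrite -(us (maxn m n)) ?leq_maxr//.
by rewrite mt// leq_maxl.
Qed.

Lemma eventual_none u :
  ~ (exists s n, forall k, (n <= k)%N -> u k = s) -> eventual u = point.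
Proof. by move=> h; rewrite /eventual; case: pselect. Qed.

Lemma measurable_eventual dT (T : measurableType dT) (X : nat -> T -> S) :
  (forall k s, measurable [set t | X k t = s]) ->
  forall s, measurable [set t | eventual (X ^~ t) = s].
Proof.
move=> mX s.
pose A s := \bigcup_n \bigcap_(k in [set k | (n <= k)%N]) [set t | X k t = s].
have mA a : measurable (A a).
  by apply: bigcupT_measurable => n; apply: bigcap_measurableType => k _; exact: mX.
have EA t a : A a t -> eventual (X ^~ t) = a.
  by move=> [n _ h]; apply: (@eventualE _ a n).
have nA t : ~ (exists a, A a t) -> eventual (X ^~ t) = point.
  move=> h; apply: eventual_none => -[a [n nX]]; apply: h.
  by exists a, n.
have -> : [set t | eventual (X ^~ t) = s]
    = A s `|` (~` (\bigcup_(a in [set: S]) A a) `&` [set _ | s = point]).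
  apply/seteqP; split=> t /=.
    move=> ts; have [[a Aa]|h] := pselect (exists a, A a t).
      by left; rewrite -ts (EA t a Aa).
    by right; split; [move=> [a _ Aa]; apply: h; exists a|rewrite -ts nA].
  move=> [/EA//|[h ->]]; apply: nA => -[a Aa]; apply: h.
  by exists a.
apply: measurableU => //; apply: measurableI.
  by apply: measurableC; apply: fin_bigcup_measurable => //; exact: finite_finset.
have [sp|sp] := pselect (s = point).
  have -> : [set _ | s = point] = [set: T] by apply/seteqP; split.
  exact: measurableT.
have -> : [set _ | s = point] = set0 :> set T by apply/seteqP; split.
exact: measurable0.
Qed.

End Eventual.

(** * Equivariance under tree automorphisms *)

Section Equivariance.
Context (d : nat) (S : finType).
Local Notation noise := (noise d S).
Local Notation coordinate := (coordinate d).
Context (g : vertex d -> vertex d) (hg : automorphism g).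
Implicit Types (c : coordinate -> noise) (v : vertex d).

Lemma automorphism_step v :
  exists2 f : 'I_d -> 'I_d, injective f & forall i, g (step i v) = step (f i) (g v).
Proof.
have [bg ag] := hg.
have h i : exists j, g (step i v) == step j (g v).
  apply/existsP; rewrite -/(adj (g v) (g (step i v))) ag.
  by apply/existsP; exists i.
pose f i := xchoose (h i); have fE i : g (step i v) = step (f i) (g v).
  by apply/eqP; exact: xchooseP (h i).
exists f => // i j fij; apply: (@step_inj d v); apply: (bij_inj bg).
by rewrite !fE fij.
Qed.

(** An automorphism does not respect the numbering of the neighbours by ['I_d], so the noise must
    give the same answer when both neighbourhoods are renumbered by the same permutation. Decoded
    noise does: its answer depends on the request only through its law. *)
Definition symmetric_answers c := forall i (f : 'I_d -> 'I_d), injective f ->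
  forall (w w' : {ffun 'I_d -> S}) a,
    answer (c i) (ask_coupled [ffun k => w (f k)] [ffun k => w' (f k)] a)
    = answer (c i) (ask_coupled w w' a).

Definition pull c : coordinate -> noise := fun i => c (i.1, g i.2).

Definition equivariant (L : layer d S) := forall c, symmetric_answers c ->
  forall m v, state L (pull c) m v = state L c m (g v)
    /\ innov L (pull c) m v = innov L c m (g v).

Lemma active_pull c m v : active (pull c) m v = active c m (g v).
Proof.
have [f fi fE] := automorphism_step v.
rewrite /active; congr (_ && _); apply/forallP/forallP => h i.
  have [f' _ ff'] := injF_bij fi.
  by have := h (f' i); rewrite /bit /pull /= fE ff'.
by rewrite /bit /pull /= fE; exact: h.
Qed.

(** The start is a constant configuration and hence looks the same from every vertex; a start such
    as [branch] would single out the root. *)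
Lemma equivariant_next L K s0 j : equivariant L ->
  equivariant (next_layer L K (fun _ _ => s0) j).
Proof.
move=> eL c sc.
have coupledE m v x : coupled_innov L j (pull c) m v (x \o g)
    = coupled_innov L j c m (g v) x.
  have [f fi fE] := automorphism_step v.
  rewrite /coupled_innov (eL c sc m v).2.
  have -> : nbr (x \o g) v = [ffun k => nbr x (g v) (f k)].
    by apply/ffunP => k; rewrite !ffunE /= fE.
  have -> : nbr (state L (pull c) m.+1) v = [ffun k => nbr (state L c m.+1) (g v) (f k)].
    by apply/ffunP => k; rewrite !ffunE (eL c sc _ _).1 fE.
  exact: (sc ((m, j), g v) f fi).
have runE n : run L K (fun _ _ => s0) j (pull c) n = run L K (fun _ _ => s0) j c n \o g.
  elim: n => [|n IH] //=; apply/funext => v /=.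
  by rewrite active_pull IH coupledE.
by move=> m v; split; rewrite /= runE//= coupledE.
Qed.

Lemma equivariant_nth s0 k : equivariant (nth_layer d s0 k).
Proof.
elim: k => [|k IH]; last exact: equivariant_next.
by move=> c sc m v; split.
Qed.

End Equivariance.

(** * Existence and law of the almost sure limit *)

Section LimitProcess.
Context (R : realType) (d : nat) (S : pointedFinType) (pi : S -> R) (Q : S -> S -> R).
Hypothesis hd : (2 <= d)%N.
Hypothesis hQ : reversible_chain pi Q.
Hypothesis hB : forall w : {ffun 'I_d -> S}, 0 < nbhd_prob pi Q w.
Hypothesis hD : dobrushin d pi Q < d%:R^-1.
Local Notation L := (labelling d R).
Local Notation mu := (@iid_law d R).
Local Notation noise_of := (noise_of pi Q).
Local Notation rate := (rate d pi Q).
Local Notation layer_at k := (nth_layer d (point : S) k).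

Definition coalescent k (x : L) v : S := state (layer_at k) (noise_of x) 0 v.

Lemma noise_symmetric (x : L) : symmetric_answers (noise_of x).
Proof.
by move=> i f fi w w' a; rewrite /answer !ffunE /= !cond_law_perm.
Qed.

Lemma coalescent_equivariant g k (x : L) v : automorphism g ->
  coalescent k (x \o g) v = coalescent k x (g v).
Proof.
by move=> hg; exact: (equivariant_nth hg (point : S) k (noise_symmetric x) 0 v).1.
Qed.

Definition factor (x : L) : discrete S := eventual (fun k => coalescent k x (root d)).

Lemma factor_mapE (x : L) v : factor_map factor x v = eventual (fun k => coalescent k x v).
Proof.
rewrite /factor_map /factor; congr eventual; apply/funext => k.
by rewrite coalescent_equivariant ?shift_root//; exact: shift_automorphism.
Qed.

Lemma factor_root_invariant : root_invariant factor.
Proof.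
move=> g hg gr x; congr eventual; apply/funext => k.
by rewrite coalescent_equivariant// gr.
Qed.

Let gk k := nth_layer_good hQ hB (point : S) (noise_law_answer hQ hB) k.

Lemma measurable_coalescent k v s : measurable [set x : L | coalescent k x v = s].
Proof.
apply: (measurable_noise_local pi Q (E := fun c => state (layer_at k) c 0 v = s)).
by apply: (local_comp (fun a => a = s)); exact: good_local_state (gk k) _ _.
Qed.

Lemma measurable_limit v s :
  measurable [set x : L | eventual (fun k => coalescent k x v) = s].
Proof.
apply: (measurable_eventual (X := fun k x => coalescent k x v)).
by move=> k a; exact: measurable_coalescent.
Qed.

Lemma measurable_limit_fun v :
  measurable_fun setT (fun x : L => eventual (fun k => coalescent k x v) : discrete S).
Proof.
move=> _ B _; rewrite setTI; apply: (measurable_finite_valued (measurable_limit v)).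
Qed.

Lemma measurable_factor : measurable_fun setT factor.
Proof. exact: measurable_limit_fun. Qed.

Lemma measurable_factor_map :
  measurable_fun setT (factor_map factor : L -> coloring d S).
Proof.
apply: measurable_configuration => v.
have -> : (fun x : L => factor_map factor x v)
    = (fun x : L => eventual (fun k => coalescent k x v)).
  by apply/funext => x; exact: factor_mapE.
exact: measurable_limit_fun.
Qed.

Definition factor_law : probability (coloring d S) R :=
  [the probability _ _ of image_measure mu measurable_factor_map].

Let rate_ge0 : 0 <= rate.
Proof.
have D0 := dobrushin_ge0 d pi Q.
have p1 : active_prob R d <= 1 by rewrite exprn_ile1// ?invr_ge0// invf_le1// ler1n.
have p0 : 0 <= active_prob R d by rewrite exprn_ge0// invr_ge0.
rewrite /rate; have : 0 <= d%:R * dobrushin d pi Q by rewrite mulr_ge0.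
by move: (d%:R * _) => z; nra.
Qed.

(** This is where the assumption that the Dobrushin coefficient is below 1/d enters. *)
Let rate_lt1 : rate < 1.
Proof.
have p0 : 0 < active_prob R d by rewrite exprn_gt0// invr_gt0.
rewrite /rate gtrBl mulr_gt0// subr_gt0 mulrC -ltr_pdivlMr ?mul1r//.
by rewrite ltr0n ltnW.
Qed.

Let pr (A : set L) : R := fine (mu A).

Let prE A : measurable A -> mu A = (pr A)%:E.
Proof. by move=> mA; rewrite fineK//; exact: fin_num_measure. Qed.

Let pr_le A B N : measurable A -> measurable B -> measurable N ->
  A `<=` B `|` N -> pr A <= pr B + pr N.
Proof.
move=> mA mB mN ABN; rewrite -lee_fin EFinD -!prE//.
apply: (@le_trans _ _ (mu (B `|` N))).
  by apply: le_measure; rewrite ?inE//; exact: measurableU.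
exact: measureU2.
Qed.

Let a0 : noise d S := (true, [ffun=> point]).

Lemma coalescent_step k v :
  pr [set x : L | coalescent k x v != coalescent k.+1 x v] <= rate ^+ k.
Proof.
rewrite /pr (iid_law_local pi Q a0
  (E := fun c => state (layer_at k) c 0 v != state (layer_at k.+1) c 0 v)).
  exact: (nth_layer_disagree hQ hB a0 point (noise_law_ge0 pi Q)
    (noise_law_sum1 d pi Q) (noise_law_answer hQ hB) (noise_law_coin d pi Q)).
by apply: (local_comp2 (fun a b => a != b)); exact: good_local_state (gk _) _ _.
Qed.

Lemma geometric_sum_le n k :
  \sum_(j < n) rate ^+ (k + j) <= rate ^+ k / (1 - rate).
Proof.
rewrite ler_pdivlMr ?subr_gt0//.
suff -> : (\sum_(j < n) rate ^+ (k + j)) * (1 - rate) = rate ^+ k - rate ^+ (k + n).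
  by rewrite gerBl exprn_ge0.
elim: n => [|n IH]; first by rewrite big_ord0 mul0r addn0 subrr.
by rewrite big_ord_recr /= mulrDl IH addnS exprS; ring.
Qed.

Let bad k v : set L :=
  [set x | eventual (fun k => coalescent k x v) != coalescent k x v].

Let measurable_bad k v : measurable (bad k v).
Proof.
have -> : bad k v = ~` (\bigcup_(s in [set: S])
    ([set x : L | eventual (fun k => coalescent k x v) = s]
     `&` [set x | coalescent k x v = s])).
  apply/seteqP; split=> x /=.
    by move=> /eqP h [s _ [/= h1 h2]]; apply: h; rewrite h1 h2.
  by move=> h; apply/eqP => h1; apply: h; exists (coalescent k x v).
apply: measurableC; apply: fin_bigcup_measurable => [|s _]; first exact: finite_finset.
by apply: measurableI; [exact: measurable_limit|exact: measurable_coalescent].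
Qed.

(** If no two consecutive trajectories differ at [v] from index [k] on, the sequence is constant
    from there and [eventual] returns its [k]-th term. Subadditivity leaves the tail of a geometric
    series. *)
Lemma coalescent_limit k v : pr (bad k v) <= rate ^+ k / (1 - rate).
Proof.
pose D j := [set x : L | coalescent (k + j) x v != coalescent (k + j).+1 x v].
have mD j : measurable (D j).
  apply: (measurable_noise_local pi Q
    (E := fun c => state (layer_at (k + j)) c 0 v != state (layer_at (k + j).+1) c 0 v)).
  apply: (local_comp2 (fun a b : S => is_true (a != b)));
    exact: good_local_state (gk _) _ _.
rewrite -lee_fin -prE//.
apply: (@le_trans _ _ (\sum_(j <oo) mu (D j))%E).
  apply: measure_sigma_subadditive => // x /eqP xb.
  apply: contrapT => h; apply: xb; apply: (@eventualE _ _ _ k) => n kn.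
  rewrite -(subnKC kn); elim: (n - k)%N => [|j IH]; first by rewrite addn0.
  rewrite addnS -IH; apply/esym/eqP/negPn/negP => hj; apply: h.
  by exists j.
apply: lime_le; first exact: is_cvg_nneseries.
apply: nearW => n.
rewrite (eq_bigr (fun j => (pr (D j))%:E)) => [|j _]; last exact: prE.
rewrite sumEFin lee_fin; apply: le_trans (geometric_sum_le n k).
by rewrite big_mkord; apply: ler_sum => j _; exact: coalescent_step.
Qed.

Let badF k (s : seq (vertex d)) : set L := [set x | exists2 v, v \in s & bad k v x].

Let badF_cons k v s : badF k (v :: s) = bad k v `|` badF k s.
Proof.
apply/seteqP; split=> x /=.
  by move=> [w]; rewrite inE => /predU1P[->|ws] bw; [left|right; exists w].
by move=> [bv|[w ws bw]]; [exists v; rewrite ?inE ?eqxx|exists w; rewrite ?inE ?ws ?orbT].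
Qed.

Let badF_nil k : badF k [::] = set0.
Proof. by apply/seteqP; split=> // x []. Qed.

Let measurable_badF k s : measurable (badF k s).
Proof.
elim: s => [|v s IH]; first by rewrite badF_nil.
by rewrite badF_cons; exact: measurableU.
Qed.

Let badF_le k s : pr (badF k s) <= (size s)%:R * (rate ^+ k / (1 - rate)).
Proof.
elim: s => [|v s IH]; first by rewrite badF_nil /pr measure0 mul0r.
apply: le_trans (@pr_le _ (bad k v) (badF k s) _ _ _ _) _ => //; first by rewrite badF_cons.
by rewrite /= -natr1 mulrDl mul1r addrC lerD// coalescent_limit.
Qed.

Let limit_cyl (F : {fset vertex d}) (x : vertex d -> S) : set L :=
  [set y | forall v, v \in F -> eventual (fun k => coalescent k y v) = x v].

Let coalescent_cyl k (F : {fset vertex d}) (x : vertex d -> S) : set L :=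
  [set y | forall v, v \in F -> coalescent k y v = x v].

Let measurable_limit_cyl F x : measurable (limit_cyl F x).
Proof.
apply: (fin_bigcap_measurable (D := [set v | v \in F])) => [|v _].
  exact: finite_fset.
exact: measurable_limit.
Qed.

Let measurable_coalescent_cyl k F x : measurable (coalescent_cyl k F x).
Proof.
apply: (fin_bigcap_measurable (D := [set v | v \in F])) => [|v _].
  exact: finite_fset.
exact: measurable_coalescent.
Qed.

Let coalescent_cyl_le k F x : tree_closed F ->
  `|pr (coalescent_cyl k F x) - cylinder_weight pi Q F x| <= #|` F|%:R * rate ^+ k.
Proof.
move=> cF.
have -> : pr (coalescent_cyl k F x)
    = expect (noise_law pi Q) a0 (fun c =>
        (all (fun v => state (layer_at k) c 0 v == x v) F)%:R).
  rewrite /pr -[RHS]/(fine (_%:E)) -(iid_law_local pi Q a0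
    (E := fun c => all (fun v => state (layer_at k) c 0 v == x v) F)); last first.
    apply: (local_seqP (r := F) (g := fun v c => state (layer_at k) c 0 v)
      (h := fun f => all (fun v => f v == x v) F)) => [v|f f' ff'].
      exact: good_local_state (gk k) _ _.
    by apply: eq_in_all => v vF; rewrite ff'.
  congr (fine (mu _)); apply/seteqP; split=> y /=.
    by move=> h; apply/allP => v /h /eqP.
  by move=> /allP h v /h /eqP.
exact: (nth_layer_cylinder hQ hB a0 point (noise_law_ge0 pi Q)
  (noise_law_sum1 d pi Q) (noise_law_answer hQ hB) (noise_law_coin d pi Q)).
Qed.

Lemma limit_cylinder F x : tree_closed F ->
  pr (limit_cyl F x) = cylinder_weight pi Q F x.
Proof.
move=> cF; apply/eqP; rewrite -subr_eq0 -normr_le0.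
(* The first summand pays for replacing the limit by the [k]-th trajectory on [F], the second for
   the distance of the latter from the branching law. *)
pose K : R := #|` F|%:R * (1 - rate)^-1 + #|` F|%:R.
have h k : `|pr (limit_cyl F x) - cylinder_weight pi Q F x| <= K * rate ^+ k.
  rewrite -(subrKA (pr (coalescent_cyl k F x))) mulrDl.
  apply: le_trans (ler_normD _ _) _; apply: lerD; last exact: coalescent_cyl_le.
  rewrite -mulrA [_^-1 * _]mulrC; apply: le_trans (badF_le k F).
  rewrite ler_distl; apply/andP; split.
    rewrite lerBlDr; apply: pr_le => // y hy.
    have [b|nb] := pselect (badF k F y); first by right.
    left=> v vF; rewrite -hy//; apply/eqP/negPn/negP => h1.
    by apply: nb; exists v.
  apply: pr_le => // y hy.
  have [b|nb] := pselect (badF k F y); first by right.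
  left=> v vF; rewrite -hy//; apply/esym/eqP/negPn/negP => h1.
  by apply: nb; exists v => //; rewrite /bad /= eq_sym.
have cv : geometric K rate @ \oo --> (0 : R).
  by apply: cvg_geometric; rewrite ger0_norm.
rewrite -(cvg_lim _ cv)//; apply: limr_ge; first by apply/cvg_ex; exists 0.
by apply: nearW => k; exact: h.
Qed.

Lemma factor_law_branching : branching_markov pi Q factor_law.
Proof.
move=> F x rF pF; rewrite -[RHS]/((cylinder_weight pi Q F x)%:E) -limit_cylinder//.
rewrite -prE//; congr (mu _); apply/seteqP; split=> y /= h v vF.
  by rewrite -factor_mapE; exact: h.
by rewrite factor_mapE; exact: h.
Qed.

End LimitProcess.

Theorem theorem2 (R : realType) (d : nat) (S : pointedFinType)
    (pi : S -> R) (Q : S -> S -> R)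
    (hd : (2 <= d)%N)
    (hQ : reversible_chain pi Q)
    (hB : forall w : {ffun 'I_d -> S}, 0 < nbhd_prob pi Q w)
    (hD : dobrushin d pi Q < d%:R^-1) :
  (exists nu : probability (coloring d S) R, branching_markov pi Q nu) /\
  (forall nu : probability (coloring d S) R,
     branching_markov pi Q nu -> factor_of_iid nu).
Proof.
have bm := factor_law_branching hd hQ hB hD.
split; first by exists (factor_law hQ hB).
move=> nu bnu; exists [the probability _ _ of @iid_law d R]; first exact: iid_law_uniform.
exists (factor pi Q); split.
- exact: measurable_factor.
- exact: factor_root_invariant.
(* [factor_law] is the pushforward of [iid_law] under the factor map, so uniqueness identifies it
   with [nu]. *)
- by move=> A mA; exact: branching_markov_unique bnu bm A mA.
Qed.
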